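(* BigTwoDisjointSets $\le_{ql}$ BigSpernerFamily.
   Context: Quasilinear reductions: for an instance $I$ let $s(I)$ be its size. A quasilinear Karp reduction from problem $\mathcal P$ to problem $\mathcal Q$ (written $\mathcal P\le_{ql}\mathcal Q$) is a function $\Phi$ from instances of $\mathcal P$ to instances of $\mathcal Q$ such that for every instance $I$ of $\mathcal P$: $\Phi(I)$ can be computed in time $\tilde O(s(I))$ (that is, $O(s(I)\log^j s(I))$ for a fixed $j$), and $I$ and $\Phi(I)$ have the same output. In the following problems the input is a finite set $X$ and a collection $\mathcal C$ of subsets of $X$ with $|X|<\log^{c}(|\mathcal C|)$ for a fixed constant $c$ (sets represented as lists of elements). BigTwoDisjointSets: output True if there are two disjoint sets $C,C'\in\mathcal C$, False otherwise. BigSpernerFamily: output True if there are two (distinct) sets $C,C'\in\mathcal C$ with $C\subseteq C'$, False otherwise. *)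

(* Defs.v *)
From mathcomp Require Import all_boot all_order all_algebra.
From mathcomp Require Import reals exp.
Set Implicit Arguments.
Unset Strict Implicit.
Unset Printing Implicit Defensive.

(** Model of computation: structured programs for a random access machine with
    a read-only input tape and a write-only output tape, under the logarithmic
    cost criterion.  The only arithmetic is addition and truncated subtraction,
    so unbounded words give no extra power. *)

Definition bitlen (n : nat) : nat := (trunc_log 2 n).+1.

Inductive instr : Type :=
| IConst of nat & nat         (* r_i := n *)
| IAdd of nat & nat & nat     (* r_i := r_j + r_k *)
| ISub of nat & nat & nat     (* r_i := r_j - r_k, truncated *)
| ILoad of nat & nat          (* r_i := ram[r_j] *)
| IStore of nat & nat         (* ram[r_i] := r_j *)
| IRead of nat                (* r_i := next input word, 0 if none is left *)
| IWrite of nat.              (* append r_i to the output *)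

Inductive prog : Type :=
| Skip
| Do of instr
| Seq of prog & prog
| IfPos of nat & prog & prog  (* if 0 < r_i then .. else .. *)
| WhilePos of nat & prog.     (* while 0 < r_i do .. *)

Record state : Type := State {
  reg : nat -> nat;
  ram : nat -> nat;
  inp : seq nat;
  out : seq nat }.

Definition upd (f : nat -> nat) (i v : nat) : nat -> nat :=
  fun k => if k == i then v else f k.

Definition set_reg (s : state) (i v : nat) : state :=
  State (upd (reg s) i v) (ram s) (inp s) (out s).

Definition run_instr (a : instr) (s : state) : state :=
  match a with
  | IConst i n => set_reg s i n
  | IAdd i j k => set_reg s i (reg s j + reg s k)
  | ISub i j k => set_reg s i (reg s j - reg s k)
  | ILoad i j => set_reg s i (ram s (reg s j))
  | IStore i j => State (reg s) (upd (ram s) (reg s i) (reg s j)) (inp s) (out s)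
  | IRead i =>
      State (upd (reg s) i (head 0 (inp s))) (ram s) (behead (inp s)) (out s)
  | IWrite i => State (reg s) (ram s) (inp s) (rcons (out s) (reg s i))
  end.

(** Register indices are fixed by the program, so they are not charged; memory
    addresses and all operands are. *)
Definition cost_instr (a : instr) (s : state) : nat :=
  match a with
  | IConst _ n => bitlen n
  | IAdd _ j k | ISub _ j k => bitlen (reg s j) + bitlen (reg s k)
  | ILoad _ j => bitlen (reg s j) + bitlen (ram s (reg s j))
  | IStore i j => bitlen (reg s i) + bitlen (reg s j)
  | IRead _ => bitlen (head 0 (inp s))
  | IWrite i => bitlen (reg s i)
  end.

(** [exec p s t s']: started in [s], [p] halts in [s'] after time [t]. *)
Inductive exec : prog -> state -> nat -> state -> Prop :=
| exec_skip s : exec Skip s 0 s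
| exec_do a s : exec (Do a) s (cost_instr a s) (run_instr a s)
| exec_seq p q s1 s2 s3 t u :
    exec p s1 t s2 -> exec q s2 u s3 -> exec (Seq p q) s1 (t + u) s3
| exec_if i p q s t s' :
    exec (if 0 < reg s i then p else q) s t s' ->
    exec (IfPos i p q) s (bitlen (reg s i) + t) s'
| exec_while_stop i p s :
    reg s i = 0 -> exec (WhilePos i p) s (bitlen (reg s i)) s
| exec_while_step i p s1 s2 s3 t u :
    0 < reg s1 i -> exec p s1 t s2 -> exec (WhilePos i p) s2 u s3 ->
    exec (WhilePos i p) s1 (bitlen (reg s1 i) + t + u) s3.

Definition init (w : seq nat) : state := State (fun=> 0) (fun=> 0) w [::].

Definition computes (p : prog) (w : seq nat) (t : nat) (w' : seq nat) : Prop :=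
  exists s, exec p (init w) t s /\ out s = w'.

Record problem : Type := Problem {
  instance : Type;
  encode : instance -> seq nat;
  output : instance -> bool }.

Definition isize (P : problem) (I : instance P) : nat :=
  \sum_(n <- encode I) bitlen n.

Definition ql_reducible (P Q : problem) : Prop :=
  exists Phi : instance P -> instance Q,
    (exists (p : prog) (T : instance P -> nat),
       (forall I, computes p (encode I) (T I) (encode (Phi I))) /\
       (exists j K s0 : nat, forall I, s0 <= isize I ->
          T I <= K * (isize I * trunc_log 2 (isize I) ^ j))) /\
    (forall I, output I = output (Phi I)).

Notation "P <=ql Q" := (ql_reducible P Q) (at level 70, no associativity).

Definition log2 (R : realType) (x : R) : R := (ln x / ln 2)%R.

(** A finite set is a duplicate-free list of element names (natural numbers);
    two such lists are the same set iff they are [perm_eq]. *)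
Record big_family (R : realType) (c : R) : Type := BigFamily {
  ground : seq nat;
  members : seq (seq nat);
  ground_uniq : uniq ground;
  members_set : all (fun C => uniq C && all [in ground] C) members;
  members_distinct : pairwise (fun C C' => ~~ perm_eq C C') members;
  ground_small : ((size ground)%:R < log2 (size members)%:R `^ c)%R }.

(** Length-prefixed, hence self-delimiting; an empty member still occupies one
    word. *)
Definition encode_set (C : seq nat) : seq nat := size C :: C.

Definition encode_family (R : realType) (c : R) (I : big_family c) : seq nat :=
  encode_set (ground I) ++
  size (members I) :: flatten [seq encode_set C | C <- members I].

Definition two_disjoint (R : realType) (c : R) (I : big_family c) : bool :=
  has (fun C => has (fun C' => ~~ perm_eq C C' && ~~ has [in C] C')
                    (members I)) (members I).

Definition has_inclusion (R : realType) (c : R) (I : big_family c) : bool :=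
  has (fun C => has (fun C' => ~~ perm_eq C C' && all [in C'] C)
                    (members I)) (members I).

Definition BigTwoDisjointSets (R : realType) (c : R) : problem :=
  Problem (@encode_family R c) (@two_disjoint R c).

Definition BigSpernerFamily (R : realType) (c : R) : problem :=
  Problem (@encode_family R c) (@has_inclusion R c).

(* Main.v *)
(** Write [X] for the ground set, [d] for its size, [n] for the number of
    members and [L = log2 n].  Two sets are disjoint iff the first is included
    in the complement of the second, so the reduction outputs a left copy of
    every member [C] and a right copy of every complement [X \ C].  New elements
    must ensure that left copies are pairwise incomparable, that right copies
    are, and that no right copy is included in a left one.

    The output has to satisfy the bound [|X'| < (log2 n')^c] for the same [c],
    which leaves no room for codes of [n] members.  But distinct sets of the same
    size are already incomparable, so it is enough to encode the size [|C| <= d].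
    Take [h] with [2^h > d] and output [2^h] copies of each set, where copy [u]
    carries the [2h]-bit number [v = |C| + u 2^h], written by choosing one
    element out of each of [2h] pairs: codes of different numbers are
    incomparable.  Left copies use one zone of [4h] new elements; right copies
    contain that whole zone and use a second one.  Then [n' = 2^(h+1) n] and
    [(L + h + 1)^c >= L^c + h^c >= L^c + 8h] as soon as [h^(c-1) >= 8], which a
    constant lower bound on [h] achieves when [c > 1].  For [c <= 1] there is no
    instance at all, because [n <= 2^d].  The empty member, whose left copy is
    included in its own right copies, is harmless: it is disjoint from any other
    member and [n >= 2].

    For the time bound, elements must be renamed to [1..d]: an element with a
    long name may occur in most complements.  The renaming is done by direct
    addressing, at cost the length of the name. *)
Require Import Defs.
From mathcomp Require Import all_boot all_order all_algebra.
From mathcomp Require Import boolp reals exp.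
From mathcomp Require Import zify.

Set Implicit Arguments.
Unset Strict Implicit.
Unset Printing Implicit Defensive.
Import Order.TTheory GRing.Theory Num.Theory.

(** * Bit lengths *)

Lemma bitlen_gt0 n : 0 < bitlen n. Proof. by []. Qed.

Lemma leq_bitlen m n : m <= n -> bitlen m <= bitlen n.
Proof. by move=> le_mn; rewrite ltnS leq_trunc_log. Qed.

Lemma ltn_bitlen n : n < 2 ^ bitlen n.
Proof. exact: trunc_log_ltn. Qed.

(** Positivity of [m] matters because [bitlen 0 = 1]. *)
Lemma bitlen_leP m n : 0 < m -> (bitlen n <= m) = (n < 2 ^ m).
Proof.
case: m => // m _; apply/idP/idP => [le|lt].
  by apply: leq_trans (ltn_bitlen n) _; rewrite leq_exp2l.
case: n lt => [|n] lt; first by rewrite /bitlen trunc_log0.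
have /andP[le1 _] := @trunc_log_bounds 2 n.+1 isT isT.
by rewrite -[bitlen _ <= _](@ltn_exp2l 2) //; apply: leq_ltn_trans lt.
Qed.

Lemma bitlen_double n : bitlen (n + n) <= (bitlen n).+1.
Proof. by rewrite bitlen_leP // expnS; have := ltn_bitlen n; lia. Qed.

(** * Reasoning about programs *)

Definition target (a : instr) : seq nat :=
  match a with
  | IConst i _ | IAdd i _ _ | ISub i _ _ | ILoad i _ | IRead i => [:: i]
  | IStore _ _ | IWrite _ => [::]
  end.

Definition is_store a := if a is IStore _ _ then true else false.
Definition is_read a := if a is IRead _ then true else false.
Definition is_write a := if a is IWrite _ then true else false.

Fixpoint mods (p : prog) : seq nat :=
  match p with
  | Skip => [::]
  | Do a => target a
  | Seq p q | IfPos _ p q => mods p ++ mods q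
  | WhilePos _ p => mods p
  end.

Fixpoint uses (f : instr -> bool) (p : prog) : bool :=
  match p with
  | Skip => false
  | Do a => f a
  | Seq p q | IfPos _ p q => uses f p || uses f q
  | WhilePos _ p => uses f p
  end.

(** Read off the syntax: a component that no instruction of [p] can change keeps its value. This
    carries known register contents past a subprogram without analysing it again. *)
Definition frame (p : prog) (s s' : state) : Prop :=
  [/\ forall r, r \notin mods p -> reg s' r = reg s r,
      ~~ uses is_store p -> ram s' = ram s,
      ~~ uses is_read p -> inp s' = inp s &
      ~~ uses is_write p -> out s' = out s].

Lemma frame_sub p q s s' :
  {subset mods p <= mods q} ->
  (forall f, uses f p -> uses f q) ->
  frame p s s' -> frame q s s'.
Proof.
move=> mpq upq [fr fm fi fo]; split=> [r nr|nu|nu|nu].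
- by apply: fr; apply: contra nr; apply: mpq.
- by apply: fm; apply: contra nu; apply: upq.
- by apply: fi; apply: contra nu; apply: upq.
- by apply: fo; apply: contra nu; apply: upq.
Qed.

Lemma frame_trans p s1 s2 s3 : frame p s1 s2 -> frame p s2 s3 -> frame p s1 s3.
Proof.
move=> [fr fm fi fo] [gr gm gi go]; split=> [r nr|nu|nu|nu].
- by rewrite gr // fr.
- by rewrite gm // fm.
- by rewrite gi // fi.
- by rewrite go // fo.
Qed.

Lemma exec_frame p s t s' : exec p s t s' -> frame p s s'.
Proof.
elim=> {p s t s'} //=.
- by case=> [i n|i j k|i j k|i j|i j|i|i] s; split=> //= r;
    rewrite /upd ?inE => /negPf->.
- move=> p q s1 s2 s3 t u _ f1 _ f2.
  apply: (@frame_trans _ _ s2); [move: f1 | move: f2]; apply: frame_sub => /= [r|f].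
  + by rewrite mem_cat => ->.
  + by move=> ->.
  + by rewrite mem_cat orbC => ->.
  + by rewrite orbC => ->.
- move=> i p q s t s' _; case: ifP => _; apply: frame_sub => /= [r|f].
  + by rewrite mem_cat => ->.
  + by move=> ->.
  + by rewrite mem_cat orbC => ->.
  + by rewrite orbC => ->.
- move=> i p s1 s2 s3 t u _ _ f1 _ f2.
  by apply: (frame_trans _ f2); apply: frame_sub f1.
Qed.

(** A total-correctness triple; [t] is only an upper bound, so costs may be rounded up at each
    composition. *)
Definition runs (p : prog) (s : state) (t : nat) (R : state -> Prop) : Prop :=
  exists t' s', [/\ exec p s t' s', t' <= t & R s'].

Lemma runs_conseq p s t t' (R R' : state -> Prop) :
  runs p s t R -> t <= t' -> (forall s', frame p s s' -> R s' -> R' s') ->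
  runs p s t' R'.
Proof.
move=> [u [s' [e le_u r]]] le_t RR'; exists u, s'; split=> //.
  exact: leq_trans le_t.
by apply: RR' r; apply: exec_frame e.
Qed.

Lemma runs_le p s t t' R : runs p s t R -> t <= t' -> runs p s t' R.
Proof. by move=> r le; apply: (runs_conseq r le). Qed.

Lemma runs_skip s t (R : state -> Prop) : R s -> runs Skip s t R.
Proof. by move=> r; exists 0, s; split=> //; constructor. Qed.

Lemma runs_seq p q s t1 t2 R :
  runs p s t1 (fun s' => runs q s' t2 R) -> runs (Seq p q) s (t1 + t2) R.
Proof.
move=> [u1 [s1 [e1 l1 [u2 [s2 [e2 l2 r]]]]]]; exists (u1 + u2), s2; split=> //.
  by apply: exec_seq e1 e2.
exact: leq_add.
Qed.

Lemma runs_if i p q s t R :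
  runs (if 0 < reg s i then p else q) s t R ->
  runs (IfPos i p q) s (bitlen (reg s i) + t) R.
Proof.
move=> [u [s' [e l r]]]; exists (bitlen (reg s i) + u), s'; split=> //.
  by constructor.
by rewrite leq_add2l.
Qed.

Fixpoint block (l : seq instr) : prog :=
  if l is a :: l' then Seq (Do a) (block l') else Skip.

Fixpoint run_block (l : seq instr) (s : state) : state :=
  if l is a :: l' then run_block l' (run_instr a s) else s.

Fixpoint cost_block (l : seq instr) (s : state) : nat :=
  if l is a :: l' then cost_instr a s + cost_block l' (run_instr a s) else 0.

Lemma runs_block l s t (R : state -> Prop) :
  R (run_block l s) -> cost_block l s <= t -> runs (block l) s t R.
Proof.
move=> r le; exists (cost_block l s), (run_block l s); split=> //.
elim: l s {r le} => [|a l IH] s /=; first by constructor.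
by apply: exec_seq (IH _); constructor.
Qed.

(* Counts register [c] down to 0; register 0 must hold the constant 1. *)
Definition For (c : nat) (p : prog) : prog :=
  WhilePos c (Seq p (Do (ISub c c 0))).

(** In each round, [3 * bitlen n] pays for the test of the counter and for its decrement, whose
    operands are the counter and 1; the final [.+1] is the failing test, as [bitlen 0 = 1]. The
    invariant is required after the decrement, hence the [set_reg]. *)
Lemma runs_for c p n (t : nat -> nat) (I : nat -> state -> Prop) s :
  reg s c = n -> reg s 0 = 1 -> c \notin 0 :: mods p -> 0 \notin mods p ->
  I 0 s ->
  (forall k s1, k < n -> I k s1 -> frame (For c p) s s1 ->
     runs p s1 (t k) (fun s2 => I k.+1 (set_reg s2 c (n - k.+1)))) ->
  runs (For c p) s (\sum_(k < n) (t k + 3 * bitlen n)).+1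
    (fun s' => I n s' /\ reg s' c = 0).
Proof.
move=> sc s0; rewrite inE negb_or => /andP[c0 cp] p0 I0 step.
(* Induction on the number [m] of rounds still to come, [k] being the number already done. *)
suff loop m k s1 : n = k + m -> I k s1 -> frame (For c p) s s1 ->
    reg s1 c = m -> reg s1 0 = 1 ->
    runs (For c p) s1 (\sum_(k <= j < n) (t j + 3 * bitlen n)).+1
      (fun s' => I n s' /\ reg s' c = 0).
  rewrite -(big_mkord xpredT (fun j => t j + 3 * bitlen n)).
  by apply: (loop n 0).
elim: m k s1 => [|m IH] k s1 nkm Ik fr s1c s10.
  have -> : n = k by rewrite nkm addn0.
  exists (bitlen (reg s1 c)), s1; split=> //; first exact: exec_while_stop.
  by rewrite s1c /bitlen trunc_log0.
have lt_kn : k < n by lia.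
have [u [s2 [e2 l2 I2]]] := step k s1 lt_kn Ik fr.
have f2 := exec_frame e2.
set s3 := run_instr (ISub c c 0) s2.
have [fr2 _ _ _] := f2.
have s2c : reg s2 c = m.+1 by rewrite fr2.
have s20 : reg s2 0 = 1 by rewrite fr2.
have s3E : s3 = set_reg s2 c (n - k.+1).
  by rewrite /s3 /= s2c s20; congr set_reg; lia.
have e3 : exec (Seq p (Do (ISub c c 0))) s1 (u + cost_instr (ISub c c 0) s2) s3.
  by apply: exec_seq e2 _; constructor.
have f3 := exec_frame e3.
have [|||||v [s4 [e4 l4 r4]]] := IH k.+1 s3.
- by lia.
- by rewrite s3E.
- exact: frame_trans fr f3.
- by rewrite s3E /= /upd eqxx; lia.
- by rewrite s3E /= /upd eq_sym (negPf c0).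
exists (bitlen (reg s1 c) + (u + cost_instr (ISub c c 0) s2) + v), s4; split=> //.
  by apply: exec_while_step e3 e4; rewrite s1c.
rewrite big_ltn //= s1c s2c s20.
have := @leq_bitlen m.+1 n ltac:(lia); have -> : bitlen 1 = 1 by [].
have := bitlen_gt0 n; move: l4 l2; set S := \sum_(_ <= j < _) _; lia.
Qed.

Lemma runs_loop c p n (t : nat -> nat) (I : nat -> state -> Prop) s u
    (R : state -> Prop) :
  reg s c = n -> reg s 0 = 1 -> c \notin 0 :: mods p -> 0 \notin mods p ->
  I 0 s ->
  (forall k s1, k < n -> I k s1 -> frame (For c p) s s1 ->
     runs p s1 (t k) (fun s2 => I k.+1 (set_reg s2 c (n - k.+1)))) ->
  (\sum_(k < n) (t k + 3 * bitlen n)).+1 <= u ->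
  (forall s', frame (For c p) s s' -> I n s' -> R s') ->
  runs (For c p) s u R.
Proof.
move=> sc s0 nc n0 I0 step leu IR.
apply: (runs_conseq (runs_for sc s0 nc n0 I0 step) leu) => s' fr [In _].
exact: IR.
Qed.

Lemma runs_iter c p n t (I : nat -> state -> Prop) s u (R : state -> Prop) :
  reg s c = n -> reg s 0 = 1 -> c \notin 0 :: mods p -> 0 \notin mods p ->
  I 0 s ->
  (forall k s1, k < n -> I k s1 -> frame (For c p) s s1 ->
     runs p s1 t (fun s2 => I k.+1 (set_reg s2 c (n - k.+1)))) ->
  (n * (t + 3 * bitlen n)).+1 <= u ->
  (forall s', frame (For c p) s s' -> I n s' -> R s') ->
  runs (For c p) s u R.
Proof.
move=> sc s0 nc n0 I0 step leu IR; apply: (runs_loop sc s0 nc n0 I0 step) => //.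
by rewrite sum_nat_const card_ord.
Qed.

Lemma runs_then p q s t1 t Q R :
  runs p s t1 Q -> t1 <= t ->
  (forall s', frame p s s' -> Q s' -> runs q s' (t - t1) R) ->
  runs (Seq p q) s t R.
Proof.
move=> rp le rq; apply: (@runs_le _ _ (t1 + (t - t1))); last by lia.
by apply: runs_seq; apply: (runs_conseq rp).
Qed.

Lemma runs_block_then l q s t1 t R :
  cost_block l s <= t1 -> t1 <= t ->
  (forall s', s' = run_block l s -> frame (block l) s s' ->
     runs q s' (t - t1) R) ->
  runs (Seq (block l) q) s t R.
Proof.
move=> lec le rq; apply: (@runs_then _ _ _ t1 _ (eq^~ (run_block l s))) => //.
  exact: runs_block.
by move=> s' fr e; apply: rq.
Qed.

(** * The reduction program *)

(* For [P = 2 ^ m] and [w < P], the [j]-th most significant bit of [w] selects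
   one of [q + 2 j + 1] and [q + 2 j + 2]. *)
Fixpoint code (P m w q : nat) : seq nat :=
  if m is m'.+1 then
    if P <= w + w then q.+2 :: code P m' (w + w - P) q.+2
    else q.+1 :: code P m' (w + w) q.+2
  else [::].

(** Once the height is found, [rD], [rH], [rN], [rP] hold [d], [h], [2 ^ h], [4 ^ h]. [rK] is the
    size of the current member, [rU] counts the copies still to be written, [rV] is the number to be
    encoded, [rW] what is left of it, and [rE] the number of zone elements to be included outright.
    No program writes to [rZero], so its initial 0 turns an addition into a move. *)
Notation rOne := 0 (only parsing).
Notation rD := 1 (only parsing).
Notation rH := 2 (only parsing).
Notation rN := 3 (only parsing).
Notation rP := 4 (only parsing).
Notation rH2 := 5 (only parsing).
Notation rH4 := 6 (only parsing).
Notation rMem := 7 (only parsing).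
Notation rK := 8 (only parsing).
Notation rA := 9 (only parsing).
Notation rI := 10 (only parsing).
Notation rCnt := 11 (only parsing).
Notation rU := 12 (only parsing).
Notation rV := 13 (only parsing).
Notation rW := 14 (only parsing).
Notation rT := 15 (only parsing).
Notation rSz := 16 (only parsing).
Notation rE := 17 (only parsing).
Notation rZero := 18 (only parsing).

Notation Mov i j := (IAdd i j rZero).

Definition write_iota : prog :=
  For rCnt (block [:: IAdd rI rI rOne; IWrite rI]).

Definition write_code : prog :=
  For rCnt (Seq (block [:: IAdd rW rW rW; IAdd rT rW rOne; ISub rT rT rP;
                           IAdd rI rI rOne])
                (IfPos rT (block [:: ISub rW rW rP; IAdd rI rI rOne; IWrite rI])
                          (block [:: IWrite rI; IAdd rI rI rOne]))).

(* The last instruction of the block negates the mark when [b] is false; it is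
   written so that the set of modified registers does not depend on [b]. *)
Definition write_marked (b : bool) : prog :=
  For rCnt (Seq (block [:: IAdd rI rI rOne; IAdd rA rI rI; IAdd rA rA rOne;
                           ILoad rT rA;
                           ISub rT (if b then rT else rOne)
                                   (if b then rZero else rT)])
                (IfPos rT (block [:: IWrite rI]) Skip)).

Definition write_set (b : bool) : prog :=
  Seq (block [:: IWrite rSz; IConst rI 0; Mov rCnt rD])
 (Seq (write_marked b)
 (Seq (block [:: Mov rCnt rE])
 (Seq write_iota
 (Seq (block [:: Mov rCnt rH2; Mov rW rV])
 (Seq write_code
      (block [:: IAdd rV rV rN])))))).

Definition write_sets (b : bool) : prog :=
  Seq (block [:: Mov rU rN; Mov rV rK]) (For rU (write_set b)).

Lemma iota_rcons m n : iota m n.+1 = rcons (iota m n) (m + n).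
Proof. by rewrite -addn1 iotaD cats1. Qed.

Ltac simpl_regs := rewrite /= /upd /=.

(* Transports the known register contents along a frame hypothesis. *)
Ltac push_regs :=
  repeat match goal with
  | F : (forall r, is_true (r \notin _) -> reg ?s' r = reg ?s r),
    H : reg ?s ?k = _ |- _ => rewrite -(F k isT) in H
  end.

(** Replaces each bit length of a value at most [M] by an unknown at most [B], so that cost goals
    become plain arithmetic. *)
Ltac bound_bitlen :=
  repeat match goal with
  | BM : (forall m, is_true (m <= _) -> is_true (bitlen m <= _))
    |- context [bitlen ?a] =>
    have := BM a ltac:(lia); move: (bitlen a) => ? ?
  end.

(** * Effect and cost of the writing routines *)

Section Routines.

Variables (B M : nat).
Hypothesis bitlenM : forall m, m <= M -> bitlen m <= B.

Lemma write_iota_runs e i s :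
  reg s rOne = 1 -> reg s rI = i -> reg s rCnt = e -> 0 < M -> i + e <= M ->
  runs write_iota s (e * (6 * B)).+1
    (fun s' => reg s' rI = i + e /\ out s' = out s ++ iota i.+1 e).
Proof.
move=> s0 si sc M0 leM.
apply: (@runs_iter _ _ _ (3 * B)
   (fun k s' => reg s' rI = i + k /\ out s' = out s ++ iota i.+1 k)
   _ _ _ sc s0) => //.
- by rewrite /= addn0 cats0.
- move=> k s1 ltk [s1i s1o] [fr _ _ _]; push_regs.
  rewrite iota_rcons; apply: runs_block; simpl_regs.
    rewrite s0 s1i s1o rcons_cat; split; last congr (_ ++ rcons _ _); lia.
  rewrite s0 s1i; bound_bitlen; lia.
- bound_bitlen; nia.
Qed.

Lemma write_code_runs P m w q s :
  reg s rOne = 1 -> reg s rP = P -> reg s rW = w -> reg s rI = q ->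
  reg s rCnt = m -> w < P -> P + P <= M -> q + m + m <= M -> m <= M ->
  runs write_code s (m * (20 * B)).+1
    (fun s' => out s' = out s ++ code P m w q).
Proof.
move=> s0 sP sw si sc ltw leP leq lem.
(* The invariant says that the output so far, followed by the code of the bits still held in [rW],
   is the complete target. *)
apply: (@runs_iter _ _ _ (16 * B)
   (fun k s' => [/\ reg s' rI = q + k + k, reg s' rW < P &
      out s' ++ code P (m - k) (reg s' rW) (reg s' rI) = out s ++ code P m w q])
   _ _ _ sc s0) => //.
- by rewrite si sw subn0 !addn0.
- move=> k s1 ltk [s1i s1w s1o] [fr _ _ _]; push_regs.
  rewrite (_ : m - k = (m - k.+1).+1) /= ?s1i in s1o; last by lia.
  apply: (@runs_le _ _ (8 * B + (B + 5 * B))); last by bound_bitlen; lia.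
  apply: runs_seq; apply: runs_block; last first.
    by simpl_regs; rewrite s0 s1i sP; bound_bitlen; lia.
  set s2 := run_block _ _.
  (* With truncation, [2 w + 1 - P] is positive exactly when [P <= 2 w], that is, when the leading
     bit of [w] is 1. *)
  have s2T : reg s2 rT = (reg s1 rW + reg s1 rW).+1 - P.
    by rewrite /s2; simpl_regs; rewrite s0 sP addn1.
  apply: (@runs_le _ _ (bitlen (reg s2 rT) + 5 * B)); last first.
    by rewrite s2T; bound_bitlen; lia.
  apply: runs_if; rewrite s2T subn_gt0 ltnS; move: s1o.
  case: ifP => lePw s1o; apply: runs_block; rewrite /s2; simpl_regs.
  + rewrite s0 sP s1i; split; [lia|lia|].
    rewrite -s1o cat_rcons; do 2 f_equal; [lia|]; f_equal; lia.
  + by rewrite s0 sP s1i; bound_bitlen; lia.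
  + rewrite s0 s1i; split; [lia|lia|].
    rewrite -s1o cat_rcons; do 2 f_equal; [lia|]; f_equal; lia.
  + by rewrite s0 s1i; bound_bitlen; lia.
- bound_bitlen; nia.
- by move=> s' _ [_ _]; rewrite subnn /= cats0 => ->.
Qed.

Lemma write_marked_runs b (S : seq nat) d s :
  reg s rOne = 1 -> reg s rZero = 0 -> reg s rI = 0 -> reg s rCnt = d ->
  (forall i, ram s (i + i + 1) = (i \in S)) -> (d + d).+1 <= M ->
  runs (write_marked b) s (d * (20 * B)).+1
    (fun s' => reg s' rI = d /\
       out s' = out s ++ [seq i <- iota 1 d | (i \in S) == b]).
Proof.
move=> s0 sz si sc rm leM.
apply: (@runs_iter _ _ _ (14 * B)
   (fun k s' => reg s' rI = k /\
      out s' = out s ++ [seq i <- iota 1 k | (i \in S) == b])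
   _ _ _ sc s0) => //.
- by rewrite /= si cats0.
- move=> k s1 ltk [s1i s1o] [fr /(_ isT) fm _ _]; push_regs.
  apply: (@runs_block_then _ _ _ (10 * B)); last 1 first.
  + move=> s2 s2E [fr2 /(_ isT) fm2 _ /(_ isT) fo2].
    have s2T : reg s2 rT = ((k.+1 \in S) == b).
      by rewrite s2E; case: b {s1o fr fr2 s2E}; simpl_regs;
        rewrite s0 ?sz s1i fm (addn1 k) rm; case: (_ \in S).
    have s2i : reg s2 rI = k.+1 by rewrite s2E; simpl_regs; rewrite s1i s0 addn1.
    apply: (@runs_le _ _ (bitlen (reg s2 rT) + B)); last first.
      by rewrite s2T; case: (_ == b); bound_bitlen; lia.
    apply: runs_if; rewrite s2T iota_rcons filter_rcons add1n.
    case: (_ == b); [apply: runs_block | apply: runs_skip]; simpl_regs;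
      rewrite ?s2i ?fo2 ?s1o ?rcons_cat //; bound_bitlen; lia.
  + by case: b {s1o fr}; simpl_regs; rewrite s0 s1i ?sz fm (addn1 k) rm;
      case: (_ \in S); bound_bitlen; lia.
  + by lia.
- bound_bitlen; nia.
Qed.

Lemma write_set_runs b (S : seq nat) d e m P N v z s :
  reg s rOne = 1 -> reg s rZero = 0 -> reg s rD = d -> reg s rE = e ->
  reg s rH2 = m -> reg s rP = P -> reg s rN = N -> reg s rV = v ->
  reg s rSz = z ->
  (forall i, ram s (i + i + 1) = (i \in S)) ->
  (d + d).+1 <= M -> P + P <= M -> d + e + m + m <= M -> N <= M -> z <= M ->
  v < P -> 0 < B ->
  runs (write_set b) s ((d + e + m).+1 * (40 * B))
    (fun s' => reg s' rV = v + N /\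
       out s' = out s ++ z :: [seq i <- iota 1 d | (i \in S) == b] ++
                  iota d.+1 e ++ code P m v (d + e)).
Proof.
move=> s0 sz sd se sm sP sN sv ss rm lM1 lM2 lM3 lM4 lM5 ltv B0.
apply: (@runs_block_then _ _ _ (4 * B)) => [||s1 s1E [fr fm _ _]].
- by simpl_regs; rewrite ss sd sz; have -> : bitlen 0 = 1 by []; bound_bitlen; lia.
- by nia.
have s1i : reg s1 rI = 0 by rewrite s1E.
have s1c : reg s1 rCnt = d by rewrite s1E; simpl_regs; rewrite sd sz addn0.
have s1o : out s1 = rcons (out s) z by rewrite s1E; simpl_regs; rewrite ss.
push_regs; rewrite -(fm isT) in rm; clear s1E fr fm.
apply: (runs_then (write_marked_runs b s0 sz s1i s1c rm lM1)) => [|s2 [fr fm _ _] [s2i s2o]].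
  by nia.
push_regs; rewrite -(fm isT) in rm; clear fr fm.
apply: (@runs_block_then _ _ _ (2 * B)) => [||s3 s3E [fr fm _ fo]].
- by simpl_regs; rewrite se sz; bound_bitlen; lia.
- by nia.
have s3c : reg s3 rCnt = e by rewrite s3E; simpl_regs; rewrite se sz addn0.
have s3o := fo isT.
push_regs; clear s3E fr fm fo.
apply: (runs_then (write_iota_runs s0 s2i s3c _ _))
  => [|||s4 [fr fm _ _] [s4i s4o]].
- by lia.
- by lia.
- by nia.
push_regs; clear fr fm.
apply: (@runs_block_then _ _ _ (4 * B)) => [||s5 s5E [fr fm _ fo]].
- by simpl_regs; rewrite sm sz sv; bound_bitlen; lia.
- by nia.
have s5c : reg s5 rCnt = m by rewrite s5E; simpl_regs; rewrite sm sz addn0.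
have s5w : reg s5 rW = v by rewrite s5E; simpl_regs; rewrite sv sz addn0.
have s5o := fo isT.
push_regs; clear s5E fr fm fo.
apply: (runs_then (write_code_runs s0 sP s5w s4i s5c ltv lM2 _ _))
  => [|||s6 [fr fm _ _] s6o].
- by lia.
- by lia.
- by nia.
push_regs; clear fr fm.
apply: runs_block; simpl_regs.
  by rewrite sv sN s6o s5o s4o s3o s2o s1o -!catA cat_rcons.
by rewrite sv sN; bound_bitlen; nia.
Qed.

Lemma write_sets_runs b (S : seq nat) d e m P N k z s :
  reg s rOne = 1 -> reg s rZero = 0 -> reg s rD = d -> reg s rE = e ->
  reg s rH2 = m -> reg s rP = P -> reg s rN = N -> reg s rK = k ->
  reg s rSz = z ->
  (forall i, ram s (i + i + 1) = (i \in S)) ->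
  (d + d).+1 <= M -> P + P <= M -> d + e + m + m <= M -> N <= M -> z <= M ->
  k < N -> N * N <= P -> 0 < B ->
  runs (write_sets b) s (N * ((d + e + m).+1 * (50 * B)))
    (fun s' =>
       out s' = out s ++ flatten
         [seq z :: [seq i <- iota 1 d | (i \in S) == b] ++
                  iota d.+1 e ++ code P m (k + u * N) (d + e) | u <- iota 0 N]).
Proof.
move=> s0 sz sd se sm sP sN sk ss rm lM1 lM2 lM3 lM4 lM5 ltk leNP B0.
have N0 : 0 < N by apply: leq_ltn_trans ltk.
apply: (@runs_block_then _ _ _ (4 * B)) => [||s1 s1E [fr fm _ fo]].
- by simpl_regs; rewrite sk sN sz; bound_bitlen; lia.
- by nia.
have s1u : reg s1 rU = N by rewrite s1E; simpl_regs; rewrite sN sz addn0.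
have s1v : reg s1 rV = k by rewrite s1E; simpl_regs; rewrite sk sz addn0.
have s1o := fo isT.
push_regs; rewrite -(fm isT) in rm; clear s1E fr fm fo.
apply: (@runs_iter _ _ _ ((d + e + m).+1 * (40 * B))
   (fun j s' => reg s' rV = k + j * N /\
      out s' = out s ++ flatten
         [seq z :: [seq i <- iota 1 d | (i \in S) == b] ++
                  iota d.+1 e ++ code P m (k + u * N) (d + e) | u <- iota 0 j])
   _ _ _ s1u s0) => //.
- by rewrite /= cats0 addn0.
- move=> j s2 ltj [s2v s2o] [fr fm _ fo]; push_regs; rewrite -(fm isT) in rm; clear fr fm fo.
  have ltv : k + j * N < P by nia.
  apply: (runs_conseq (write_set_runs b s0 sz sd se sm sP sN s2v ss rm _ _ _ _ _ ltv B0)) => //.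
  move=> s3 _ [s3v s3o]; rewrite iota_rcons map_rcons flatten_rcons; simpl_regs.
  by rewrite s3v s3o s2o !catA add0n; split=> //; lia.
- by bound_bitlen; nia.
- by move=> s' _ [].
Qed.

End Routines.

(** * Renamed members and the gadgets built from them *)

Definition names (X C : seq nat) : seq nat := [seq (index x X).+1 | x <- C].

(* Even addresses hold the new names, odd addresses the membership marks. *)
Definition name_table (X : seq nat) (r : nat -> nat) : Prop :=
  forall x, x \in X -> r (x + x) = (index x X).+1.

Definition marks (S : seq nat) (r : nat -> nat) : Prop :=
  forall i, r (i + i + 1) = (i \in S).

(** A left copy of the member ([b] true) or a right copy of its complement ([b] false); [S] is the
    renamed member and [k] its size. The first zone runs from [d + 1] to [d + 4 h]: left copies put
    their code there, right copies contain all of it and put their code behind it. A code of [2 h]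
    bits needs [4 h] elements, and [k + u * 2 ^ h < 4 ^ h] when [k] and [u] are below [2 ^ h]. *)
Definition gadget (d h : nat) (S : seq nat) (k : nat) (b : bool) (u : nat) :=
  let e := if b then 0 else 4 * h in
  [seq i <- iota 1 d | (i \in S) == b] ++ iota d.+1 e ++
  code (4 ^ h) (2 * h) (k + u * 2 ^ h) (d + e).

Definition gadgets (d h : nat) (S : seq nat) (k : nat) (b : bool) :=
  [seq gadget d h S k b u | u <- iota 0 (2 ^ h)].

Lemma size_code P m w q : size (code P m w q) = m.
Proof. by elim: m w q => //= m IH w q; case: ifP => _ /=; rewrite IH. Qed.

Lemma mem_names X C x : x \in X -> {subset C <= X} ->
  ((index x X).+1 \in names X C) = (x \in C).
Proof.
move=> Xx CX; apply/mapP/idP => [[y Cy [e]]|Cx]; last by exists x.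
by rewrite -(nth_index 0 Xx) e nth_index // CX.
Qed.

Lemma names_range X C i : {subset C <= X} -> i \in names X C -> 0 < i <= size X.
Proof. by move=> CX /mapP[x /CX Xx ->]; rewrite /= index_mem. Qed.

Lemma uniq_names X C : uniq C -> {subset C <= X} -> uniq (names X C).
Proof.
move=> uC CX; rewrite map_inj_in_uniq // => x y /CX Xx /CX Xy [e].
by rewrite -(nth_index 0 Xx) e nth_index.
Qed.

Lemma count_names X C : uniq C -> {subset C <= X} ->
  count [in names X C] (iota 1 (size X)) = size C.
Proof.
move=> uC CX; rewrite -size_filter -[RHS](size_map (fun x => (index x X).+1)).
apply: perm_size; apply: uniq_perm; rewrite ?filter_uniq ?iota_uniq ?uniq_names //.
move=> i; rewrite mem_filter mem_iota andb_idr // => /(names_range CX).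
by rewrite add1n ltnS.
Qed.

(** The length of a set is output before its elements, so the program needs it in closed form. *)
Lemma size_gadget X C h b u : uniq C -> {subset C <= X} ->
  size (gadget (size X) h (names X C) (size C) b u) =
  if b then size C + 2 * h else size X - size C + 6 * h.
Proof.
move=> uC CX; rewrite !size_cat size_iota size_code size_filter.
have cC := count_names uC CX.
case: b; first by rewrite (@eq_count _ _ [in names X C]) ?cC // => i /=; case: (_ \in _).
rewrite (@eq_count _ _ (predC [in names X C])); last by move=> i /=; case: (_ \in _).
by have := count_predC [in names X C] (iota 1 (size X)); rewrite size_iota cC; lia.
Qed.

(** * Programs for one member and for the whole input *)

Definition mark : prog :=
  For rCnt (block [:: IRead rA; IAdd rA rA rA; ILoad rI rA; IAdd rA rI rI;
                      IAdd rA rA rOne; IStore rA rOne]).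

(** The input can be read only once, so the marks of a member cannot be undone by rereading it; all
    [d] of them are erased instead. *)
Definition unmark : prog :=
  Seq (block [:: IConst rI 0; Mov rCnt rD])
      (For rCnt (block [:: IAdd rI rI rOne; IAdd rA rI rI; IAdd rA rA rOne;
                           IStore rA rZero])).

Definition member : prog :=
  Seq (block [:: IRead rK; Mov rCnt rK])
 (Seq mark
 (Seq (block [:: IAdd rSz rK rH2; IConst rE 0])
 (Seq (write_sets true)
 (Seq (block [:: ISub rSz rD rK; IAdd rSz rSz rH4; IAdd rSz rSz rH2;
                 Mov rE rH4])
 (Seq (write_sets false)
      unmark))))).

Definition read_ground : prog :=
  For rCnt (block [:: IRead rA; IAdd rI rI rOne; IAdd rA rA rA; IStore rA rI]).

(** [rN] is doubled as long as it is at most [d]. Running the loop [d] times suffices because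
    [bitlen d <= d] for positive [d]. *)
Definition find_height : prog :=
  For rCnt (Seq (block [:: IAdd rT rD rOne; ISub rT rT rN])
                (IfPos rT (block [:: IAdd rN rN rN; IAdd rP rP rP;
                                     IAdd rP rP rP; IAdd rH rH rOne])
                          Skip)).

Definition reduction (H : nat) : prog :=
  Seq (block [:: IConst rOne 1; IRead rD; IConst rI 0; Mov rCnt rD])
 (Seq read_ground
 (Seq (block [:: IConst rH H; IConst rN (2 ^ H); IConst rP (4 ^ H);
                 Mov rCnt rD])
 (Seq find_height
 (Seq (block [:: IAdd rH2 rH rH; IAdd rH4 rH2 rH2; IAdd rCnt rH4 rH4;
                 IAdd rCnt rD rCnt; IWrite rCnt; IConst rI 0])
 (Seq write_iota
 (Seq (block [:: IRead rMem; IAdd rT rMem rMem; Mov rCnt rH])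
 (Seq (For rCnt (block [:: IAdd rT rT rT]))
 (Seq (block [:: IWrite rT])
      (For rMem member))))))))).

(** * Run on a single member *)

Section Phases.

Variables (B M : nat).
Hypothesis bitlenM : forall m, m <= M -> bitlen m <= B.

Lemma mark_runs X C rest s :
  reg s rOne = 1 -> reg s rCnt = size C -> inp s = C ++ rest ->
  {subset C <= X} -> name_table X (ram s) -> marks [::] (ram s) ->
  (size X + size X).+1 <= M -> size C <= M ->
  runs mark s (\sum_(x <- C) (4 * bitlen x + 12 * B)).+1
    (fun s' => [/\ inp s' = rest, name_table X (ram s') &
                   marks (names X C) (ram s')]).
Proof.
move=> s0 sc sin CX tbl mk leM leC.
(* Only reading, doubling and addressing handle the original name [x]; they cost at most [bitlen x],
   [2 * bitlen x] and [bitlen x + 1]. All other words are at most [M]. *)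
apply: (@runs_loop _ _ _ (fun k => 4 * bitlen (nth 0 C k) + 8 * B)
   (fun k s' => [/\ inp s' = drop k C ++ rest, name_table X (ram s') &
                   marks (names X (take k C)) (ram s')])
   _ _ _ sc s0) => //.
- by rewrite drop0 take0.
- move=> k s1 ltk [s1in s1t s1m] [fr _ _ _]; push_regs.
  rewrite (drop_nth 0 ltk) in s1in.
  have Xx : nth 0 C k \in X by rewrite CX // mem_nth.
  have ltx := Xx; rewrite -index_mem in ltx.
  apply: runs_block; simpl_regs; rewrite s0 s1in /= s1t //.
    split; first by [].  
    (* Marks go to odd addresses, so the table at the even ones survives. *)
    + by move=> x Xy; rewrite /=; case: eqP => [|_]; [lia | exact: s1t].
    + move=> i; rewrite (take_nth 0 ltk) /names map_rcons mem_rcons inE /=.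
      rewrite s1m; case: (i =P _) => [->|ni]; first by rewrite eqxx.
      by case: eqP => [|//]; lia.
  have := @bitlenM 0 isT; have := bitlen_double (nth 0 C k).
  by have -> : bitlen 0 = 1 by []; bound_bitlen; lia.
- rewrite (big_nth 0) big_mkord ltnS; apply: leq_sum => k _.
  by have := @bitlenM _ leC; lia.
- by move=> s' _; rewrite drop_size take_size.
Qed.

Lemma unmark_runs X S s :
  reg s rOne = 1 -> reg s rZero = 0 -> reg s rD = size X ->
  name_table X (ram s) -> marks S (ram s) ->
  (forall i, i \in S -> 0 < i <= size X) ->
  (size X + size X).+1 <= M -> 0 < B ->
  runs unmark s ((size X).+1 * (20 * B))
    (fun s' => name_table X (ram s') /\ marks [::] (ram s')).
Proof.
move=> s0 sz sd tbl mk rgS leM B0.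
apply: (@runs_block_then _ _ _ (4 * B)) => [||s1 s1E [fr fm _ _]].
- by simpl_regs; rewrite sd sz; have -> : bitlen 0 = 1 by []; bound_bitlen; lia.
- by nia.
have s1i : reg s1 rI = 0 by rewrite s1E.
have s1c : reg s1 rCnt = size X by rewrite s1E; simpl_regs; rewrite sd sz addn0.
push_regs; rewrite -(fm isT) in tbl mk; clear s1E fr fm.
apply: (@runs_iter _ _ _ (10 * B)
   (fun k s' => [/\ reg s' rI = k, name_table X (ram s') &
      marks [seq i <- S | k < i] (ram s')])
   _ _ _ s1c s0) => //.
- split=> // i; rewrite mk mem_filter; case Si: (i \in S); last by rewrite andbF.
  by have /andP[-> _] := rgS _ Si.
- move=> k s2 ltk [s2i s2t s2m] [fr _ _ _]; push_regs.
  apply: runs_block; simpl_regs; rewrite s0 s2i ?sz; last by bound_bitlen; lia.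
  split; [by rewrite addn1| |].
  + by move=> x Xx /=; case: eqP => [|_]; [lia | exact: s2t].
  + move=> i /=; rewrite s2m !mem_filter; case: eqP => [e|ne].
      by rewrite (_ : k.+1 < i = false) //; lia.
    by rewrite (_ : (k.+1 < i) = (k < i)) //; lia.
- by bound_bitlen; nia.
- move=> s' _ [_ tbl' mk']; split=> // i; rewrite mk' mem_filter.
  case Si: (i \in S); last by rewrite andbF.
  by rewrite (_ : (size X < i) = false) //; have := rgS _ Si; lia.
Qed.

Definition gadget_words (X : seq nat) h C : seq nat :=
  flatten [seq encode_set D | D <- gadgets (size X) h (names X C) (size C) true
                              ++ gadgets (size X) h (names X C) (size C) false].

Lemma member_runs X C h rest s :
  let d := size X in
  reg s rOne = 1 -> reg s rZero = 0 -> reg s rD = d ->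
  reg s rH2 = 2 * h -> reg s rH4 = 4 * h -> reg s rP = 4 ^ h ->
  reg s rN = 2 ^ h -> inp s = encode_set C ++ rest ->
  uniq C -> {subset C <= X} ->
  name_table X (ram s) -> marks [::] (ram s) ->
  (d + d).+1 <= M -> 4 ^ h + 4 ^ h <= M -> d + 8 * h <= M ->
  d < 2 ^ h -> 0 < B ->
  runs member s (2 ^ h * ((d + 6 * h).+1 * (200 * B)) +
                 \sum_(x <- C) (4 * bitlen x + 12 * B))
    (fun s' => [/\ inp s' = rest, name_table X (ram s'), marks [::] (ram s') &
                   out s' = out s ++ gadget_words X h C]).
Proof.
move=> d s0 sz sd sh2 sh4 sP sN sin uC CX tbl mk lM1 lM2 lM3 ltd B0.
have leC : size C <= d by apply: uniq_leq_size.
have P4 : 2 ^ h * 2 ^ h = 4 ^ h by rewrite -expnMn.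
set N := 2 ^ h in P4 sN ltd *; set P := 4 ^ h in P4 sP lM2 *.
have ltN : N <= P by rewrite -P4; nia.
set W := \sum_(x <- C) _.
(* [Q] is the common unit of cost: 50 for the copies on each side, 20 for unmarking, and some
   multiples of [B <= Q], which stays below 200. Once its body is cleared the remaining bounds are
   linear. *)
set Q := N * ((d + 6 * h).+1 * B).
have -> : N * ((d + 6 * h).+1 * (200 * B)) = 200 * Q by rewrite /Q; lia.
have costQ t : t <= d + 6 * h -> N * (t.+1 * (50 * B)) <= 50 * Q.
  move=> le_t; rewrite /Q !(mulnCA _ 50) leq_mul2l; apply/orP; right.
  by rewrite leq_mul2l; apply/orP; right; apply: leq_mul.
have N0 : 0 < N by rewrite expn_gt0.
have leBQ : B <= Q by rewrite -[B]mul1n -[1 * B]mul1n; apply: leq_mul => //; apply: leq_mul.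
have ledQ : d.+1 * (20 * B) <= 20 * Q.
  rewrite mulnCA leq_mul2l /= -[_ * B]mul1n; apply: leq_mul => //.
  by apply: leq_mul => //; lia.
have cost1 := costQ (d + 0 + 2 * h) ltac:(lia).
have cost2 := costQ (d + 4 * h + 2 * h) ltac:(lia).
clearbody Q; clear costQ.
have sin1 : head 0 (inp s) = size C by rewrite sin.
apply: (@runs_block_then _ _ _ (3 * B)) => [||s1 s1E [fr fm _ fo]].
- by simpl_regs; rewrite sin1 sz; bound_bitlen; lia.
- by lia.
have s1k : reg s1 rK = size C by rewrite s1E; simpl_regs.
have s1c : reg s1 rCnt = size C by rewrite s1E; simpl_regs; rewrite sin1 sz addn0.
have s1in : inp s1 = C ++ rest by rewrite s1E /= sin.
have s1o := fo isT.
push_regs; rewrite -(fm isT) in tbl mk; clear s1E fr fm fo.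
apply: (runs_then (mark_runs s0 s1c s1in CX tbl mk lM1 _))
  => [||s2 [fr _ _ fo] [s2in s2t s2m]].
- by lia.
- by rewrite -/W; lia.
have s2o := fo isT; rewrite -/W; push_regs; clear fr fo.
apply: (@runs_block_then _ _ _ (3 * B)) => [||s3 s3E [fr fm fi fo]].
- by simpl_regs; rewrite s1k sh2; have -> : bitlen 0 = 1 by []; bound_bitlen; lia.
- by lia.
have s3z : reg s3 rSz = size C + 2 * h by rewrite s3E; simpl_regs; rewrite s1k sh2.
have s3e : reg s3 rE = 0 by rewrite s3E.
have s3o := fo isT; have s3i := fi isT.
push_regs; rewrite -(fm isT) in s2t s2m; clear s3E fr fm fo fi.
have leNP : N * N <= P by rewrite P4.
have ltk : size C < N by lia.
apply: (runs_then (write_sets_runs bitlenM true s0 sz sd s3e sh2 sP sN s1k s3z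
  s2m _ _ _ _ _ ltk leNP B0))
  => [||||||s4 [fr fm fi _] s4o]; try by lia.
have s4i := fi isT.
push_regs; rewrite -(fm isT) in s2t s2m; clear fr fm fi.
apply: (@runs_block_then _ _ _ (8 * B)) => [||s5 s5E [fr fm fi fo]].
- by simpl_regs; rewrite s1k sd sz sh2 sh4; bound_bitlen; lia.
- by lia.
have s5z : reg s5 rSz = d - size C + 6 * h.
  by rewrite s5E; simpl_regs; rewrite s1k sd sh2 sh4; lia.
have s5e : reg s5 rE = 4 * h by rewrite s5E; simpl_regs; rewrite sh4 sz addn0.
have s5o := fo isT; have s5i := fi isT.
push_regs; rewrite -(fm isT) in s2t s2m; clear s5E fr fm fo fi.
apply: (runs_then (write_sets_runs bitlenM false s0 sz sd s5e sh2 sP sN s1k s5z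
  s2m _ _ _ _ _ ltk leNP B0))
  => [||||||s6 [fr fm fi _] s6o]; try by lia.
have s6i := fi isT.
push_regs; rewrite -(fm isT) in s2t s2m; clear fr fm fi.
have rgS i : i \in names X C -> 0 < i <= size X by apply: names_range.
apply: (runs_conseq (unmark_runs s0 sz sd s2t s2m rgS lM1 B0)) => [|s7 [_ _ fi fo] [s7t s7m]].
- by rewrite -/d; lia.
split=> //; first by rewrite fi // s6i s5i s4i s3i s2in.
rewrite fo // s6o s5o s4o s3o s2o s1o -!catA; congr (_ ++ _).
rewrite /gadget_words map_cat flatten_cat /gadgets -!map_comp; congr (_ ++ _).
  congr flatten; apply: eq_map => u /=; rewrite /encode_set size_gadget //.
congr flatten; apply: eq_map => u /=; rewrite /encode_set size_gadget //.
Qed.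

End Phases.

(** * The renaming table, the height and the complete run *)

Section Reduction.

Variables (B M : nat).
Hypothesis bitlenM : forall m, m <= M -> bitlen m <= B.

(** The new name of [x] is stored at address [2 x]. Since [X] has no repetitions no entry is
    overwritten, and the odd addresses stay 0. *)
Lemma read_ground_runs X rest s :
  reg s rOne = 1 -> reg s rI = 0 -> reg s rCnt = size X -> inp s = X ++ rest ->
  uniq X -> marks [::] (ram s) -> (size X).+1 <= M -> 0 < B ->
  runs read_ground s (\sum_(x <- X) (4 * bitlen x + 8 * B)).+1
    (fun s' => [/\ inp s' = rest, name_table X (ram s') & marks [::] (ram s')]).
Proof.
move=> s0 si sc sin uX mk leM B0.
apply: (@runs_loop _ _ _ (fun k => 4 * bitlen (nth 0 X k) + 5 * B)
   (fun k s' => [/\ reg s' rI = k, inp s' = drop k X ++ rest,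
      marks [::] (ram s') &
      forall x, x \in take k X -> ram s' (x + x) = (index x X).+1])
   _ _ _ sc s0) => //.
- by rewrite drop0 take0.
- move=> k s1 ltk [s1i s1in s1m s1t] [fr _ _ _]; push_regs.
  rewrite (drop_nth 0 ltk) in s1in.
  apply: runs_block; simpl_regs; rewrite s0 s1in s1i /=.
    split=> //; first by rewrite addn1.
    + by move=> i /=; case: eqP => [|_]; [lia | exact: s1m].
    + move=> x; rewrite (take_nth 0 ltk) mem_rcons inE /=.
      case/predU1P => [->|xin]; first by rewrite eqxx index_uniq // addn1.
      case: eqP => [e|_]; last exact: s1t.
      have {e} e : x = nth 0 X k by lia.
      by rewrite e index_uniq ?addn1.
  by have := bitlen_double (nth 0 X k); bound_bitlen; lia.
- rewrite (big_nth 0) big_mkord ltnS; apply: leq_sum => k _.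
  by have := @bitlenM (size X) ltac:(lia); lia.
- move=> s' _ [_ sin' mk' tbl']; split=> //; first by rewrite sin' drop_size.
  by move=> x Xx; apply: tbl'; rewrite take_size.
Qed.

Lemma find_height_runs H d s (h := maxn H (bitlen d)) :
  0 < d -> reg s rOne = 1 -> reg s rD = d -> reg s rCnt = d ->
  reg s rH = H -> reg s rN = 2 ^ H -> reg s rP = 4 ^ H ->
  d.+1 <= M -> h <= M -> 4 ^ h <= M ->
  runs find_height s (d * (20 * B)).+1
    (fun s' => [/\ reg s' rH = h, reg s' rN = 2 ^ h & reg s' rP = 4 ^ h]).
Proof.
move=> d0 s0 sd sc sH sN sP leM1 leM2 leM3.
apply: (@runs_iter _ _ _ (14 * B)
   (fun k s' => let g := minn (H + k) h in
     [/\ reg s' rH = g, reg s' rN = 2 ^ g & reg s' rP = 4 ^ g])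
   _ _ _ sc s0) => //.
- by rewrite addn0 (minn_idPl _) ?leq_maxl.
- move=> k s1 ltk; set g := minn _ _ => -[s1h s1n s1p] [fr _ _ _]; push_regs.
  have leg : 4 ^ g <= 4 ^ h by rewrite leq_exp2l // geq_minr.
  have leg2 : 2 ^ g <= 4 ^ g by rewrite (expnMn 2 2) leq_pmulr ?expn_gt0.
  have g_h : g <= h by apply: geq_minr.
  apply: (@runs_block_then _ _ _ (4 * B)) => [||s2 s2E [fr2 _ _ _]].
  + by simpl_regs; rewrite sd s0 s1n; bound_bitlen; lia.
  + by lia.
  have s2T : reg s2 rT = d.+1 - 2 ^ g by rewrite s2E; simpl_regs; rewrite sd s0 s1n addn1.
  push_regs; clear s2E fr2.
  apply: (@runs_le _ _ (bitlen (reg s2 rT) + 8 * B)); last first.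
    by rewrite s2T; bound_bitlen; lia.
  apply: runs_if; rewrite s2T subn_gt0 ltnS.
  have gtg : (2 ^ g <= d) = (g < bitlen d).
    case g0 : g => [|g']; first by rewrite d0.
    by rewrite [RHS]ltnNge bitlen_leP // -leqNgt.
  rewrite gtg; case: ltnP => hg.
  + have gS : g.+1 <= h by rewrite /h; lia.
    have -> : minn (H + k.+1) h = g.+1 by rewrite /g; lia.
    have leg' : 4 ^ g.+1 <= 4 ^ h by rewrite leq_exp2l.
    apply: runs_block; simpl_regs; rewrite s1h s1n s1p s0.
      by rewrite !expnS; split; lia.
    by rewrite expnS in leg'; bound_bitlen; lia.
  + have -> : minn (H + k.+1) h = g by rewrite /g /h in hg *; lia.
    by apply: runs_skip; simpl_regs.
- by bound_bitlen; nia.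
- move=> s' _; rewrite /= (_ : minn _ _ = h) //.
  have : bitlen d <= d by rewrite bitlen_leP // ltn_expl.
  by rewrite /h; lia.
Qed.

End Reduction.

Definition family_words (X : seq nat) (F : seq (seq nat)) : seq nat :=
  encode_set X ++ size F :: flatten [seq encode_set C | C <- F].

(** Ensures [d < 2 ^ height H d] and keeps the height above the constant [H] that the bound on the
    new ground set calls for. *)
Definition height (H d : nat) : nat := maxn H (bitlen d).

Lemma reduction_runs H X F (d := size X) (n := size F) (h := height H d)
    (B := bitlen n + 2 * h + 6) :
  0 < H -> 0 < d -> uniq X ->
  {in F, forall C, uniq C /\ {subset C <= X}} ->
  runs (reduction H) (init (family_words X F))
    (\sum_(x <- X) (4 * bitlen x + 8 * B) + 100 * ((d + 8 * h).+1 * B) +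
     \sum_(C <- F) (2 ^ h * ((d + 6 * h).+1 * (200 * B)) + 3 * B +
                 \sum_(x <- C) (4 * bitlen x + 12 * B)))
    (fun s' => out s' =
       encode_set (iota 1 (d + 8 * h)) ++ (n + n) * 2 ^ h ::
       flatten [seq gadget_words X h C | C <- F]).
Proof.
move=> H0 d0 uX FX.
(* The words to be held include [2 n 2 ^ h], [2 * 4 ^ h] and [d + 8 h]. The first [bitlen n + 2 h]
   bits account for [4 ^ h * 2 ^ bitlen n], and the six spare bits absorb the constant factors. *)
set M := (2 ^ B).-1.
have B0 : 0 < B by rewrite /B addnS.
have M2 : M.+1 = 2 ^ B by rewrite prednK // expn_gt0.
have bitlenM m : m <= M -> bitlen m <= B.
  by move=> le; rewrite bitlen_leP //; lia.
have ltd : d < 2 ^ h.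
  by apply: leq_trans (ltn_bitlen d) _; rewrite leq_exp2l // leq_maxr.
have lth : h < 2 ^ h by apply: ltn_expl.
have h0 : 0 < h by rewrite /h /height; lia.
have MB : 64 * (4 ^ h * 2 ^ bitlen n) <= M.+1.
  rewrite M2 /B (expnD _ (bitlen n + 2 * h)) (expnD _ _ (2 * h)) (expnM 2 2).
  by rewrite (_ : 2 ^ 2 = 4) // (_ : 2 ^ 6 = 64) //; lia.
have n2 : n < 2 ^ bitlen n by apply: ltn_bitlen.
have N4 : 2 ^ h * 2 ^ h = 4 ^ h by rewrite -expnMn.
have N4' : 2 ^ h <= 4 ^ h by rewrite -N4; nia.
have lM1 : 64 * 4 ^ h <= M.+1 by nia.
have lM2 : 64 * 2 ^ bitlen n <= M.+1 by nia.
have lM3 : (n + n) * 2 ^ h <= M by nia.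
clearbody M => {M2 MB}.
set s := init _.
have [s_in s_z s_o] : [/\ inp s = family_words X F, reg s rZero = 0 & out s = [::]] by [].
have mk : marks [::] (ram s) by [].
clearbody s.
set SX := \sum_(x <- X) _; set SF := \sum_(C <- F) _.
(* [A] is the unit of cost for everything outside reading [X] and the loop over the members. *)
set A := (d + 8 * h).+1 * B.
have leA1 : (d + 8 * h) * (6 * B) <= 6 * A by rewrite /A; lia.
have leA2 : d * (20 * B) <= 20 * A by rewrite /A; nia.
have leA3 : B <= A by rewrite /A; nia.
have leA4 : h * (5 * B) <= 5 * A by rewrite /A; nia.
clearbody A.
have lenH : H <= h by rewrite leq_maxl.
have sin1 : head 0 (inp s) = d by rewrite s_in.
apply: (@runs_block_then _ _ _ (5 * B)) => [||s1 s1E [fr fm _ fo]].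
- simpl_regs; rewrite sin1 s_z; have -> : bitlen 0 = 1 by [].
  by have -> : bitlen 1 = 1 by []; bound_bitlen; lia.
- by lia.
have s0 : reg s1 rOne = 1 by rewrite s1E.
have sd : reg s1 rD = d by rewrite s1E; simpl_regs.
have s1i : reg s1 rI = 0 by rewrite s1E.
have s1c : reg s1 rCnt = d by rewrite s1E; simpl_regs; rewrite sin1 s_z addn0.
have s1in : inp s1 = X ++ size F :: flatten [seq encode_set C | C <- F].
  by rewrite s1E /= s_in.
have s1o := fo isT; rewrite s_o in s1o.
push_regs; rewrite -(fm isT) in mk; clear s1E fr fm fo s_o s_in sin1.
apply: (runs_then (read_ground_runs bitlenM s0 s1i s1c s1in uX mk _ B0))
  => [||s2 [fr fm fi fo] [s2in s2t s2m]].
- by rewrite -/d; lia.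
- by rewrite -/SX; lia.
rewrite -/SX; have s2o := fo isT; rewrite s1o in s2o.
push_regs; clear fr fm fi fo s1i s1c s1in s1o mk.
have HN : 2 ^ H <= 2 ^ h by rewrite leq_exp2l.
have HP : 4 ^ H <= 4 ^ h by rewrite leq_exp2l.
apply: (@runs_block_then _ _ _ (5 * B)) => [||s3 s3E [fr fm fi fo]].
- by simpl_regs; rewrite sd s_z; bound_bitlen; lia.
- by lia.
have s3c : reg s3 rCnt = d by rewrite s3E; simpl_regs; rewrite sd s_z addn0.
have s3h : reg s3 rH = H by rewrite s3E.
have s3n : reg s3 rN = 2 ^ H by rewrite s3E.
have s3p : reg s3 rP = 4 ^ H by rewrite s3E.
have s3o := fo isT; have s3in := fi isT; rewrite s2o in s3o; rewrite s2in in s3in.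
push_regs; rewrite -(fm isT) in s2t s2m; clear s3E fr fm fi fo s2o s2in.
apply: (runs_then (find_height_runs bitlenM d0 s0 sd s3c s3h s3n s3p _ _ _))
  => [||||s4 [fr fm fi fo] [s4h s4n s4p]].
- by lia.
- by rewrite -/(height H d) -/h; lia.
- by rewrite -/(height H d) -/h; lia.
- by lia.
rewrite -/(height H d) -/h in s4h s4n s4p.
have s4o := fo isT; have s4in := fi isT; rewrite s3o in s4o; rewrite s3in in s4in.
clear s3h s3n s3p.
push_regs; rewrite -(fm isT) in s2t s2m; clear s3c fr fm fi fo s3o s3in.
apply: (@runs_block_then _ _ _ (11 * B)) => [||s5 s5E [fr fm fi _]].
- by simpl_regs; rewrite sd s4h; have -> : bitlen 0 = 1 by []; bound_bitlen; lia.
- by lia.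
have s5h2 : reg s5 rH2 = 2 * h by rewrite s5E; simpl_regs; rewrite s4h; lia.
have s5h4 : reg s5 rH4 = 4 * h by rewrite s5E; simpl_regs; rewrite s4h; lia.
have s5c : reg s5 rCnt = d + 8 * h by rewrite s5E; simpl_regs; rewrite s4h sd; lia.
have s5i : reg s5 rI = 0 by rewrite s5E.
have s5o : out s5 = [:: d + 8 * h].
  by rewrite s5E; simpl_regs; rewrite s4o s4h sd /=; congr [:: _]; lia.
have s5in := fi isT; rewrite s4in in s5in.
push_regs; rewrite -(fm isT) in s2t s2m; clear s5E fr fm fi s4in s4o.
apply: (runs_then (write_iota_runs bitlenM s0 s5i s5c _ _))
  => [|||s6 [fr fm fi _] [_ s6o]].
- by lia.
- by lia.
- by lia.
rewrite s5o in s6o; have s6in := fi isT; rewrite s5in in s6in.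
push_regs; rewrite -(fm isT) in s2t s2m; clear fr fm fi s5i s5c s5in s5o.
have sin1 : head 0 (inp s6) = n by rewrite s6in.
apply: (@runs_block_then _ _ _ (5 * B)) => [||s7 s7E [fr fm _ fo]].
- by simpl_regs; rewrite sin1 s4h s_z; bound_bitlen; lia.
- by lia.
have s7m : reg s7 rMem = n by rewrite s7E; simpl_regs.
have s7t : reg s7 rT = n + n by rewrite s7E; simpl_regs; rewrite sin1.
have s7c : reg s7 rCnt = h by rewrite s7E; simpl_regs; rewrite s4h s_z addn0.
have s7in : inp s7 = flatten [seq encode_set C | C <- F] by rewrite s7E /= s6in.
have s7o := fo isT; rewrite s6o in s7o.
push_regs; rewrite -(fm isT) in s2t s2m; clear s7E fr fm fo s6in s6o sin1.
apply: (@runs_then _ _ _ (h * (5 * B)).+1 _ (fun s' => reg s' rT = (n + n) * 2 ^ h)).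
- apply: (@runs_iter _ _ _ (2 * B)
    (fun k s' => reg s' rT = (n + n) * 2 ^ k) _ _ _ s7c s0) => //.
  + by rewrite expn0 muln1.
  + move=> k s8 ltk s8t _; have le2 : 2 ^ k <= 2 ^ h by rewrite leq_exp2l // ltnW.
    have le3 : (n + n) * 2 ^ k <= (n + n) * 2 ^ h by rewrite leq_mul2l le2 orbT.
    apply: runs_block; simpl_regs; rewrite s8t; last by bound_bitlen; lia.
    by rewrite expnS; lia.
  + by bound_bitlen; nia.
- by lia.
move=> s8 [fr fm fi fo] s8t.
have s8in := fi isT; rewrite s7in in s8in; have s8o := fo isT; rewrite s7o in s8o.
clear s7t s7c; push_regs; rewrite -(fm isT) in s2t s2m; clear fr fm fi fo s7o s7in.
apply: (@runs_block_then _ _ _ B) => [||s9 s9E [fr fm fi _]].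
- by simpl_regs; rewrite s8t; bound_bitlen; lia.
- by lia.
have s9o : out s9 = encode_set (iota 1 (d + 8 * h)) ++ [:: (n + n) * 2 ^ h].
  by rewrite s9E /= s8o s8t /encode_set size_iota -cats1.
have s9in := fi isT; rewrite s8in in s9in.
push_regs; rewrite -(fm isT) in s2t s2m; clear s8t s9E fr fm fi s8in s8o.
pose cost C := 2 ^ h * ((d + 6 * h).+1 * (200 * B)) + \sum_(x <- C) (4 * bitlen x + 12 * B).
apply: (@runs_loop _ _ _ (fun k => cost (nth [::] F k))
  (fun k s' => [/\ inp s' = flatten [seq encode_set C | C <- drop k F],
     name_table X (ram s'), marks [::] (ram s') &
     out s' = out s9 ++ flatten [seq gadget_words X h C | C <- take k F]])
  _ _ _ s7m s0) => //.
- by rewrite drop0 take0 cats0.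
- move=> k s10 ltk [s10in s10t s10m s10o] [fr _ _ _]; push_regs.
  rewrite (drop_nth [::] ltk) /= in s10in.
  have [uC CX] := FX _ (mem_nth [::] ltk).
  apply: (runs_conseq (member_runs bitlenM s0 s_z sd s5h2 s5h4 s4p s4n s10in uC CX
    s10t s10m _ _ _ ltd B0)) => //; try by rewrite -/d; lia.
  move=> s11 _ [s11in s11t s11m s11o]; split=> //.
  by rewrite /= s11o s10o (take_nth [::] ltk) map_rcons flatten_rcons catA.
(* The [3 * B] reserved for each member pays for the counter of the outer loop. *)
- have le_n := @bitlenM n ltac:(lia).
  have : \sum_(k < n) (cost (nth [::] F k) + 3 * bitlen n) <= SF; last by lia.
  rewrite /SF (big_nth [::]) big_mkord; apply: leq_sum => k _.
  by rewrite /cost addnAC leq_add2r leq_add2l leq_mul2l le_n.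
- move=> s' _ [_ _ _ ->]; rewrite take_size s9o -catA //.
Qed.

(** * Correctness of the gadget family *)

Lemma mem_code_range P m w q i : i \in code P m w q -> q < i <= q + 2 * m.
Proof.
elim: m w q => //= m IH w q.
by case: ifP => _; rewrite inE => /predU1P[->|/IH]; lia.
Qed.

Lemma uniq_code P m w q : uniq (code P m w q).
Proof.
elim: m w q => //= m IH w q; case: ifP => _ /=; rewrite IH andbT;
  by apply/negP => /mem_code_range; lia.
Qed.

(** A code has exactly one element in each pair, so inclusion forces the same choice in the first
    pair; the rest lies beyond that pair and is handled by induction. *)
Lemma code_antichain P m w w' q :
  {subset code P m w q <= code P m w' q} -> code P m w q = code P m w' q.
Proof.
elim: m w w' q => //= m IH w w' q.
set a := (w + w - P); set a' := (w' + w' - P).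
have step x x' v v' : q < x <= q.+2 -> q < x' <= q.+2 ->
    {subset x :: code P m v q.+2 <= x' :: code P m v' q.+2} ->
    x :: code P m v q.+2 = x' :: code P m v' q.+2.
  move=> rx rx' sub; have xx' : x = x'.
    have := sub x (mem_head _ _).
    by rewrite inE => /predU1P[|/mem_code_range]; lia.
  rewrite xx' (IH v v') // => y cy.
  have := sub y; rewrite !inE cy orbT => /(_ isT) /predU1P[e|//].
  by have := mem_code_range cy; lia.
by case: ifP => _; case: ifP => _; apply: step; lia.
Qed.

(** Equal codes mean [m] equal leading bits, so [w] exceeds [w'] by less than [P / 2 ^ m]. This form
    passes through the induction, where [P] stays fixed; for [P = 2 ^ m], used in both directions,
    it gives [w = w']. *)
Lemma code_inj P m w w' q : w < P -> w' < P ->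
  code P m w q = code P m w' q -> 2 ^ m * w < 2 ^ m * w' + P.
Proof.
elim: m w w' q => [|m IH] w w' q ltw ltw' /=; first by lia.
rewrite expnS; case: ifP => c1; case: ifP => c2 [].
- move=> e; have := @IH _ _ _ _ _ e; move=> /(_ ltac:(lia) ltac:(lia)).
  by rewrite !mulnBr; have := leq_mul (leqnn (2 ^ m)) c1; have := leq_mul (leqnn (2 ^ m)) c2; lia.
- by lia.
- by lia.
- by move=> e; have := @IH _ _ _ _ _ e; move=> /(_ ltac:(lia) ltac:(lia)); lia.
Qed.

Lemma code_sub_inj h v v' q : v < 4 ^ h -> v' < 4 ^ h ->
  {subset code (4 ^ h) (2 * h) v q <= code (4 ^ h) (2 * h) v' q} -> v = v'.
Proof.
move=> ltv ltv' /code_antichain e; have P0 : 0 < 4 ^ h by rewrite expn_gt0.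
have := code_inj ltv ltv' e; have := code_inj ltv' ltv (esym e).
rewrite (expnM 2 2) (_ : 2 ^ 2 = 4) //; move: (4 ^ h) P0 => P P0.
by rewrite -!(addnC P) -!mulnS !ltn_pmul2l //; lia.
Qed.

(** * Inclusions between gadgets *)

Section Gadgets.

Variables (X : seq nat) (h : nat).
Let d := size X.
Let gad (C : seq nat) b u := gadget d h (names X C) (size C) b u.

Lemma mem_gadget C b u i :
  (i \in gad C b u) =
  [|| (0 < i <= d) && ((i \in names X C) == b),
      ~~ b && (d < i <= d + 4 * h) |
      i \in code (4 ^ h) (2 * h) (size C + u * 2 ^ h)
                 (d + if b then 0 else 4 * h)].
Proof.
rewrite !mem_cat mem_filter !mem_iota add1n ltnS andbC; congr [|| _, _ | _].
by case: b => /=; lia.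
Qed.

Lemma mem_gadget_ground C b u x : x \in X -> {subset C <= X} ->
  ((index x X).+1 \in gad C b u) = ((x \in C) == b).
Proof.
move=> Xx CX; have lti := Xx; rewrite -index_mem in lti.
rewrite mem_gadget mem_names // [0 < _]/= lti /=.
have -> : (d < (index x X).+1) = false by apply/negbTE; rewrite -leqNgt.
rewrite andbF /=; case: (boolP (_ \in code _ _ _ _)); last by rewrite orbF.
move/mem_code_range => /andP[le _]; rewrite ltnS in le.
by have := leq_trans lti (leq_trans (leq_addr _ _) le); rewrite ltnn.
Qed.

Lemma gadget_uniq C b u : uniq (gad C b u).
Proof.
rewrite !cat_uniq filter_uniq ?iota_uniq // uniq_code /= andbT.
apply/andP; split; apply/hasPn => i.
  rewrite mem_cat mem_iota => /orP[|/mem_code_range] ri; rewrite mem_filter mem_iota;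
    by apply/negP => /andP[_]; lia.
by move/mem_code_range => ri; rewrite mem_iota; apply/negP; case: b ri; lia.
Qed.

Lemma gadget_ground C b u : {subset gad C b u <= iota 1 (d + 8 * h)}.
Proof.
move=> i; rewrite mem_gadget mem_iota.
by case/or3P => [|/andP[_]|/mem_code_range]; case: b; lia.
Qed.

(** On one side the codes share a zone and are incomparable unless equal, so the encoded numbers
    agree. Hence the sizes agree, and an inclusion between sets of equal size, or between their
    complements, is an equality. *)
Lemma gadget_sub_same C C' b u u' :
  size X < 2 ^ h -> uniq C -> {subset C <= X} -> uniq C' -> {subset C' <= X} ->
  u < 2 ^ h -> u' < 2 ^ h ->
  {subset gad C b u <= gad C' b u'} -> perm_eq C C' /\ u = u'.
Proof.
move=> ltX uC CX uC' CX' ltu ltu' sub.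
have leC : size C <= d by apply: uniq_leq_size.
have leC' : size C' <= d by apply: uniq_leq_size.
have N4 : 2 ^ h * 2 ^ h = 4 ^ h by rewrite -expnMn.
have e : size C + u * 2 ^ h = size C' + u' * 2 ^ h.
  apply: (@code_sub_inj h _ _ (d + if b then 0 else 4 * h)); try by rewrite -N4; nia.
  move=> i ci; have := sub i; rewrite !mem_gadget ci !orbT => /(_ isT).
  by move/mem_code_range: ci; case: b {sub} => ri /or3P[|/andP[]|//] /=; lia.
(* Sizes are at most [d < 2 ^ h], so reduction modulo [2 ^ h] recovers them. *)
have eC : size C = size C'.
  have := congr1 (modn^~ (2 ^ h)) e.
  by rewrite /= !(addnC (size _)) !modnMDl !modn_small // (leq_ltn_trans _ ltX).
have eu : u = u'.
  by move/eqP: e; rewrite eC eqn_add2l eqn_pmul2r ?expn_gt0 // => /eqP.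
split=> //.
have sCC' x : x \in X -> (x \in C) == b -> (x \in C') == b.
  by move=> Xx; rewrite -(mem_gadget_ground b u) // => /sub; rewrite mem_gadget_ground.
apply: uniq_perm => //; case: b sCC' {sub} => sCC'.
  have sub : {subset C <= C'}.
    by move=> x Cx; have := sCC' x (CX _ Cx); rewrite Cx !eqb_id => /(_ isT).
  by have [] := uniq_min_size uC sub; rewrite ?eC.
have sub : {subset C' <= C}.
  move=> x Cx; have := sCC' x (CX' _ Cx); rewrite Cx !eqbF_neg /=.
  by case: (x \in C) => // /(_ isT).
by have [] := uniq_min_size uC' sub; rewrite ?eC // => _ e' x; rewrite e'.
Qed.

(** The code of a right copy lies beyond [d + 4 * h], where left copies have no element; [0 < h]
    makes it nonempty. *)
Lemma gadget_false_sub_true C C' u u' :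
  0 < h -> ~ {subset gad C false u <= gad C' true u'}.
Proof.
move=> h_gt0 sub.
have : code (4 ^ h) (2 * h) (size C + u * 2 ^ h) (d + 4 * h) != [::].
  by rewrite -size_eq0 size_code; lia.
case E: (code _ _ _ _) => [//|i l] _.
have ci : i \in code (4 ^ h) (2 * h) (size C + u * 2 ^ h) (d + 4 * h).
  by rewrite E mem_head.
have := sub i; rewrite !mem_gadget ci !orbT => /(_ isT).
move/mem_code_range: ci => ri /or3P[|//|/mem_code_range]; lia.
Qed.

(** A right copy contains the whole first zone and with it the code of any left copy, so only the
    ground parts, [C] and the complement of [C'], are compared. *)
Lemma gadget_true_sub_false C C' u u' :
  {subset C <= X} -> {subset C' <= X} ->
  {subset gad C true u <= gad C' false u'} <-> ~~ has [in C] C'.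
Proof.
move=> CX CX'; split=> [sub|/hasPn dis].
  apply/hasPn => x C'x; have Xx := CX' _ C'x; apply/negP => Cx.
  have := sub (index x X).+1; rewrite !mem_gadget_ground //.
  by rewrite [x \in C]Cx C'x => /(_ isT).
move=> i; rewrite !mem_gadget.
case/or3P => [/andP[-> /eqP Ci]|//|/mem_code_range ri].
  rewrite eqbF_neg; case/mapP: Ci => x Cx ->.
  rewrite mem_names //; last exact: CX.
  by apply/orP; left; apply/negP => /dis /negP[].
by apply/or3P; constructor 2; rewrite /=; lia.
Qed.

End Gadgets.

(** * The output family and its answer *)

Definition gadget_family (X : seq nat) h (F : seq (seq nat)) : seq (seq nat) :=
  [seq gadget (size X) h (names X C) (size C) p.1 p.2 |
     C <- F, p <- [seq (b, u) | b <- [:: true; false], u <- iota 0 (2 ^ h)]].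

Lemma gadget_family_words X h F :
  flatten [seq encode_set D | D <- gadget_family X h F] =
  flatten [seq gadget_words X h C | C <- F].
Proof.
rewrite /gadget_family map_flatten -map_comp.
elim: F => //= C F IH; rewrite flatten_cat IH; congr (_ ++ _).
by rewrite /gadget_words /gadgets cats0 !map_cat -!map_comp.
Qed.

Lemma size_gadget_family X h F :
  size (gadget_family X h F) = (size F + size F) * 2 ^ h.
Proof. by rewrite /gadget_family !size_allpairs size_iota /=; lia. Qed.

Lemma mem_gadget_family X h F D :
  reflect (exists C b u, [/\ C \in F, u < 2 ^ h &
             D = gadget (size X) h (names X C) (size C) b u])
          (D \in gadget_family X h F).
Proof.
apply: (iffP allpairsP) => [[[C p] [CF /allpairsP[[b u] [_ ru ep]] ->]]|].
  exists C, b, u; split=> //; last by rewrite [p in LHS]ep.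
  by move: ru; rewrite mem_iota.
move=> [C [b [u [CF ltu ->]]]]; exists (C, (b, u)); split=> //.
by apply: allpairs_f; [case: b | rewrite mem_iota].
Qed.

(** A set has many listings, but a family without repeated sets contains at most one of them. *)
Lemma distinct_sets_eq F C C' :
  pairwise (fun C C' : seq nat => ~~ perm_eq C C') F ->
  C \in F -> C' \in F -> perm_eq C C' -> C = C'.
Proof.
move=> /(pairwiseP [::]) pw CF CF' pCC'.
rewrite -(nth_index [::] CF) -(nth_index [::] CF').
have lt1 : index C F < size F by rewrite index_mem.
have lt2 : index C' F < size F by rewrite index_mem.
case: (ltngtP (index C F) (index C' F)) => [lt|lt|-> //].
  by have := pw _ _ lt1 lt2 lt; rewrite !nth_index // pCC'.
by have := pw _ _ lt2 lt1 lt; rewrite !nth_index // perm_sym pCC'.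
Qed.

Lemma distinct_sets_uniq (F : seq (seq nat)) :
  pairwise (fun C C' : seq nat => ~~ perm_eq C C') F -> uniq F.
Proof. by apply: pairwise_uniq => C; rewrite perm_refl. Qed.

Section Family.

Variables (X : seq nat) (h : nat) (F : seq (seq nat)).
Hypotheses (ltX : size X < 2 ^ h) (h_gt0 : 0 < h).
Hypothesis FX : {in F, forall C, uniq C /\ {subset C <= X}}.
Hypothesis dF : pairwise (fun C C' => ~~ perm_eq C C') F.

Lemma gadget_family_sets :
  all (fun D => uniq D && all [in iota 1 (size X + 8 * h)] D)
      (gadget_family X h F).
Proof.
apply/allP => D /mem_gadget_family[C [b [u [CF ltu ->]]]].
by rewrite gadget_uniq //; apply/allP => i; apply: gadget_ground.
Qed.

Lemma gadget_family_distinct :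
  pairwise (fun D D' => ~~ perm_eq D D') (gadget_family X h F).
Proof.
(* The family is the image of a list of distinct triples of member, side and copy number, so it
   suffices that a gadget determines its triple up to permutation. *)
pose T := (seq nat * (bool * nat))%type.
pose f (t : T) := gadget (size X) h (names X t.1) (size t.1) t.2.1 t.2.2.
pose ts := [seq (b, u) | b <- [:: true; false], u <- iota 0 (2 ^ h)].
pose idx : seq T := [seq (C, p) | C <- F, p <- ts].
have -> : gadget_family X h F = map f idx by rewrite map_allpairs.
have idxP (t : T) : t \in idx -> t.1 \in F /\ t.2.2 < 2 ^ h.
  case/allpairsP => -[C p] [CF /allpairsP[[b u] [_ ru ep]] ->] /=; rewrite [p]ep.
  by split=> //; move: ru; rewrite mem_iota.
have uidx : uniq idx.
  apply: allpairs_uniq => [|| [? ?] [? ?] _ _ //]; first exact: distinct_sets_uniq dF.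
  by apply: allpairs_uniq => [|| [? ?] [? ?] _ _ //]; rewrite ?iota_uniq.
rewrite uniq_pairwise in uidx; rewrite pairwise_map.
apply: (sub_in_pairwise (P := [in idx])) uidx; last by apply/allP.
move=> t t' /idxP[tF ltu] /idxP[tF' ltu'] /=; apply: contra => /perm_mem e.
case: t t' tF ltu tF' ltu' e => [C [b u]] [C' [b' u']] /= CF ltu CF' ltu' e.
have [uC CX] := FX CF; have [uC' CX'] := FX CF'.
have s1 : {subset f (C, (b, u)) <= f (C', (b', u'))} by move=> i; rewrite e.
have s2 : {subset f (C', (b', u')) <= f (C, (b, u))} by move=> i; rewrite e.
case: b b' s1 s2 {e} => [] [] s1 s2.
- by have [p ->] := gadget_sub_same ltX uC CX uC' CX' ltu ltu' s1;
    rewrite (distinct_sets_eq dF CF CF' p).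
- by case: (gadget_false_sub_true h_gt0 s2).
- by case: (gadget_false_sub_true h_gt0 s1).
- by have [p ->] := gadget_sub_same ltX uC CX uC' CX' ltu ltu' s1;
    rewrite (distinct_sets_eq dF CF CF' p).
Qed.

Lemma gadget_family_output : 1 < size F ->
  has (fun C => has (fun C' => ~~ perm_eq C C' && ~~ has [in C] C') F) F =
  has (fun D => has (fun D' => ~~ perm_eq D D' && all [in D'] D)
                    (gadget_family X h F)) (gadget_family X h F).
Proof.
move=> F2; have N0 : 0 < 2 ^ h by rewrite expn_gt0.
apply/hasP/hasP => [[C CF /hasP[C' CF' /andP[nCC' dis]]]|].
  have [_ CX] := FX CF; have [_ CX'] := FX CF'.
  have sub := (gadget_true_sub_false h 0 0 CX CX').2 dis.
  exists (gadget (size X) h (names X C) (size C) true 0).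
    by apply/mem_gadget_family; exists C, true, 0.
  apply/hasP; exists (gadget (size X) h (names X C') (size C') false 0).
    by apply/mem_gadget_family; exists C', false, 0.
  apply/andP; split; last exact/allP.
  apply/negP => /perm_mem e; apply: (@gadget_false_sub_true X h C' C 0 0 h_gt0).
  by move=> i; rewrite e.
move=> [_ /mem_gadget_family[C [b [u [CF ltu ->]]]]].
move=> /hasP[_ /mem_gadget_family[C' [b' [u' [CF' ltu' ->]]]]].
move=> /andP[np /allP sub].
have [uC CX] := FX CF; have [uC' CX'] := FX CF'.
(* Same side: the two gadgets would coincide. Left in right: the members are disjoint. Right in
   left: impossible. *)
case: b b' np sub => [] [] np sub.
- have [p eu] := gadget_sub_same ltX uC CX uC' CX' ltu ltu' sub.
  by rewrite (distinct_sets_eq dF CF CF' p) eu perm_refl in np.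
- have dis := (gadget_true_sub_false h u u' CX CX').1 sub.
  case p: (perm_eq C C'); last first.
    by exists C => //; apply/hasP; exists C' => //; rewrite p.
  have C0 : C = [::].
    case: C p dis {CF ltu np sub uC CX} => // x C /perm_mem e /hasPn /(_ x).
    by rewrite -e mem_head => /(_ isT).
  (* A set disjoint from itself is empty, hence disjoint from any other member. *)
  have [D DF nDC] : exists2 D, D \in F & D != C.
    have ne : nth [::] F 1 != nth [::] F 0.
      by rewrite nth_uniq ?distinct_sets_uniq //; exact: ltnW.
    case: (eqVneq (nth [::] F 0) C) => [e|ne0].
      by exists (nth [::] F 1); rewrite ?mem_nth // -e.
    by exists (nth [::] F 0); rewrite ?mem_nth //; exact: ltnW.
  exists C => //; apply/hasP; exists D => //; rewrite C0; apply/andP; split.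
    by rewrite perm_sym -C0; apply: contra nDC => /(distinct_sets_eq dF DF CF) ->.
  by apply/hasPn.
- by case: (gadget_false_sub_true h_gt0 sub).
- have [p eu] := gadget_sub_same ltX uC CX uC' CX' ltu ltu' sub.
  by rewrite (distinct_sets_eq dF CF CF' p) eu perm_refl in np.
Qed.

(** Members are told apart by their characteristic vectors on [X]. *)
Lemma size_distinct_sets : size F <= 2 ^ size X.
Proof.
pose f (C : seq nat) := map_tuple [in C] (in_tuple X).
have inj_f : {in F &, injective f}.
  move=> C C' CF CF' e; have [uC CX] := FX CF; have [uC' CX'] := FX CF'.
  have mem_eq x : x \in X -> (x \in C) = (x \in C').
    move=> Xx; have := congr1 (fun t => nth false (tval t) (index x X)) e.
    by rewrite /= !(nth_map 0) ?index_mem // nth_index.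
  apply: (distinct_sets_eq dF CF CF'); apply: uniq_perm => // x.
  case Xx: (x \in X); first exact: mem_eq.
  by apply/idP/idP => [/CX|/CX']; rewrite Xx.
have : uniq (map f F) by rewrite map_inj_in_uniq // distinct_sets_uniq.
move/card_uniqP; rewrite size_map => <-.
by apply: leq_trans (max_card _) _; rewrite card_tuple card_bool.
Qed.

End Family.

(** * Size and time bounds *)

Section Logarithms.

Local Open Scope ring_scope.
Variable R : realType.

Lemma ln2_gt0 : 0 < ln 2 :> R.
Proof. by rewrite ln_gt0 // ltr1n. Qed.

(** For [n = 0] this rests on the convention [ln 0 = 0]. *)
Lemma log2_le1 n : (n <= 1)%N -> log2 (n%:R : R) = 0.
Proof. by case: n => [|[|//]] _; rewrite /log2 ?(@ln0 _ 0) ?ln1 ?mul0r. Qed.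

Lemma log2M (x y : R) : 0 < x -> 0 < y -> log2 (x * y) = log2 x + log2 y.
Proof. by move=> x0 y0; rewrite /log2 lnM ?posrE // mulrDl. Qed.

Lemma log2X n : log2 ((2 ^ n)%:R : R) = n%:R.
Proof.
by rewrite /log2 natrX lnXn ?ltr0n // -[ln _ *+ _]mulr_natl mulfK // gt_eqF // ln2_gt0.
Qed.

Lemma ler_log2 (x y : R) : 0 < x -> x <= y -> log2 x <= log2 y.
Proof.
move=> x0 xy; rewrite /log2 ler_pM2r ?invr_gt0 ?ln2_gt0 // ler_ln ?posrE //.
exact: lt_le_trans xy.
Qed.

Lemma log2_ge1 n : (1 < n)%N -> 1 <= log2 (n%:R : R).
Proof.
by move=> n1; rewrite -[leLHS]/(1%:R : R) -(log2X 1) ler_log2 ?ltr0n ?ler_nat.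
Qed.

(** Split [(x + y) ^ c] as [x (x + y) ^ (c - 1) + y (x + y) ^ (c - 1)] and use monotonicity of the
    power [c - 1]. *)
Lemma powR_superadditive (c x y : R) : 1 <= c -> 0 <= x -> 0 <= y ->
  x `^ c + y `^ c <= (x + y) `^ c.
Proof.
move=> c1 x0 y0; have c0 : 0 < c by apply: lt_le_trans c1.
rewrite -!(@mulr_powRB1 _ _ c) ?addr_ge0 // mulrDl.
by apply: lerD; apply: ler_wpM2l => //; apply: ge0_ler_powR;
  rewrite ?subr_ge0 ?nnegrE ?addr_ge0 // ?lerDl ?lerDr.
Qed.

(** For [n <= 1] the bound would be [0 ^ c = 0], and no [d] lies below it. *)
Lemma family_size_gt1 (c : R) d n : 0 < c ->
  d%:R < log2 (n%:R : R) `^ c -> (1 < n)%N.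
Proof.
move=> c0; case: ltnP => // n1; rewrite log2_le1 // powR0 ?gt_eqF //.
by rewrite ltrn0.
Qed.

(** If [c <= 1], then [log2 n >= 1] gives [(log2 n) ^ c <= log2 n <= d]. *)
Lemma family_exponent_gt1 (c : R) d n : 0 < c -> (n <= 2 ^ d)%N ->
  d%:R < log2 (n%:R : R) `^ c -> 1 < c.
Proof.
move=> c0 nd small; have n1 := family_size_gt1 c0 small.
rewrite ltNge; apply/negP => c1; move: small; apply/negP; rewrite -leNgt.
apply: (le_trans (ler1_powR (log2_ge1 n1) c1)).
by rewrite -[leRHS]log2X ler_log2 ?ler_nat // ltr0n ltnW.
Qed.

Lemma gadget_family_small (c : R) H h d n : 1 < c -> 8 <= H%:R `^ (c - 1) ->
  (0 < H <= h)%N -> d%:R < log2 (n%:R : R) `^ c ->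
  (d + 8 * h)%:R < log2 (((n + n) * 2 ^ h)%:R : R) `^ c.
Proof.
move=> c1 H8 /andP[H0 Hh] small.
have c0 : 0 < c by apply: lt_trans c1.
have n1 := family_size_gt1 c0 small.
have L1 := log2_ge1 n1; set L := log2 _ in L1 small.
have -> : log2 (((n + n) * 2 ^ h)%:R : R) = L + h.+1%:R.
  have -> : ((n + n) * 2 ^ h = n * 2 ^ h.+1)%N by rewrite expnS; lia.
  by rewrite natrM log2M ?log2X // ltr0n ?expn_gt0 // ltnW.
(* Here [h ^ c = h * h ^ (c - 1)] with [h ^ (c - 1) >= H ^ (c - 1) >= 8], which pays for the [8 h]
   new elements. *)
have h_c : (8 * h)%:R <= h%:R `^ c.
  rewrite -mulr_powRB1 // mulnC natrM ler_wpM2l //.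
  apply: (le_trans H8); apply: ge0_ler_powR; rewrite ?nnegrE // ?ler_nat //.
  by rewrite subr_ge0 ltW.
have L0 : 0 <= L by apply: le_trans L1.
apply: (@lt_le_trans _ _ (L `^ c + h%:R `^ c)); first by rewrite natrD ltr_leD.
apply: (le_trans (powR_superadditive (ltW c1) L0 (ler0n _ _))).
apply: ge0_ler_powR; rewrite ?nnegrE ?addr_ge0 // ?(ltW c0) //.
by rewrite lerD2l ler_nat.
Qed.

Lemma exists_height (c : R) : 1 < c ->
  exists2 H, (0 < H)%N & 8 <= H%:R `^ (c - 1).
Proof.
move=> c1; have c0 : 0 < c - 1 by rewrite subr_gt0.
(* The solution of [x ^ (c - 1) = 8]; any integer above it serves. *)
pose x : R := 8 `^ (c - 1)^-1.
have x0 : 0 <= x by apply: powR_ge0.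
have ltx := archi_boundP x0; set H := Num.bound x in ltx.
exists H; first by rewrite -(ltr0n R); apply: le_lt_trans ltx.
have {1}-> : 8 = x `^ (c - 1) :> R by rewrite -powRrM mulVf ?gt_eqF // powRr1.
by apply: ge0_ler_powR; rewrite ?nnegrE // ltW.
Qed.

(** For the time bound the real exponent is rounded up to a natural number [a], and [n] is replaced
    by the input size through [n <= s < 2 ^ (trunc_log 2 s).+1]. *)
Lemma ground_polylog (c : R) d n s a : 0 < c -> c <= a%:R -> (n <= s)%N ->
  d%:R < log2 (n%:R : R) `^ c -> (d <= (trunc_log 2 s).+1 ^ a)%N.
Proof.
move=> c0 ca ns small; have n1 := family_size_gt1 c0 small.
have L1 := log2_ge1 n1; rewrite -(ler_nat R); apply: (le_trans (ltW small)).
apply: (le_trans (ler_powR L1 ca)).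
rewrite powR_mulrn ?natrX; last exact: le_trans L1.
apply: lerXn2r; rewrite ?nnegrE //; first exact: le_trans L1.
rewrite -[leRHS]log2X ler_log2 // ?ltr0n ?(ltnW n1) // ler_nat.
by apply: (leq_trans ns); apply: ltnW; apply: trunc_log_ltn.
Qed.

End Logarithms.

(** * Running time against input size *)

Lemma sum_bitlen_cost B (C : seq nat) k : 0 < B ->
  \sum_(x <- C) (4 * bitlen x + k * B) <= (4 + k) * (B * \sum_(x <- C) bitlen x).
Proof.
move=> B0; rewrite !big_distrr /=; apply: leq_sum => x _.
have := bitlen_gt0 x; nia.
Qed.

Definition family_size (X : seq nat) (F : seq (seq nat)) : nat :=
  \sum_(x <- family_words X F) bitlen x.

Lemma family_sizeE X F : family_size X F =
  bitlen (size X) + \sum_(x <- X) bitlen x + bitlen (size F) +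
  \sum_(C <- F) (bitlen (size C) + \sum_(x <- C) bitlen x).
Proof.
rewrite /family_size big_cat big_cons big_cons big_flatten big_map /= !addnA.
by congr (_ + _); apply: eq_bigr => C _; rewrite big_cons.
Qed.

Lemma family_size_ge X F : size F <= family_size X F.
Proof.
rewrite family_sizeE -(sum1_size F); apply: leq_trans (leq_addl _ _).
by apply: leq_sum => C _; rewrite ltn_addr.
Qed.

(** The copies made of a member are charged to its length prefix, which contributes at least 1 to
    [s] even when the member is empty; the cost of reading a name is charged to the name. *)
Lemma reduction_time X F h B (d := size X) (s := family_size X F) :
  0 < B ->
  \sum_(x <- X) (4 * bitlen x + 8 * B) + 100 * ((d + 8 * h).+1 * B) +
     \sum_(C <- F) (2 ^ h * ((d + 6 * h).+1 * (200 * B)) + 3 * B +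
                 \sum_(x <- C) (4 * bitlen x + 12 * B)) <=
  400 * (s * (2 ^ h * ((d + 8 * h).+1 * B))).
Proof.
move=> B0; set N := 2 ^ h; have N0 : 0 < N by rewrite expn_gt0.
set A := (d + 8 * h).+1 * B; set Q := N * A.
have BA : B <= A by rewrite leq_pmull.
have AQ : A <= Q by rewrite leq_pmull.
have BQ := leq_trans BA AQ.
have s0 : 0 < s by rewrite /s family_sizeE.
have cost1 := @sum_bitlen_cost B X 8 B0.
set SX := \sum_(x <- X) bitlen x in cost1.
have cost2 : \sum_(C <- F) (N * ((d + 6 * h).+1 * (200 * B)) + 3 * B +
     \sum_(x <- C) (4 * bitlen x + 12 * B)) <=
     203 * (Q * \sum_(C <- F) (bitlen (size C) + \sum_(x <- C) bitlen x)).
  rewrite !big_distrr /=; apply: leq_sum => C _; rewrite mulnDr mulnDr.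
  apply: leq_add.
    have le1 : N * ((d + 6 * h).+1 * (200 * B)) <= 200 * Q.
      have -> : N * ((d + 6 * h).+1 * (200 * B)) = 200 * (N * ((d + 6 * h).+1 * B)) by lia.
      rewrite leq_mul2l /= leq_mul2l /A leq_mul2r ltnS leq_add2l leq_mul2r.
      by rewrite !orbT.
    have := leq_pmulr Q (bitlen_gt0 (size C)); lia.
  apply: leq_trans (@sum_bitlen_cost B C 12 B0) _.
  apply: leq_mul => //; exact: leq_mul.
set SF := \sum_(C <- F) (bitlen _ + _) in cost2.
have sE : SX + SF <= s by rewrite /s family_sizeE -/SX -/SF; lia.
have c1 : B * SX <= Q * SX by rewrite leq_mul2r BQ orbT.
have c2 : Q * (SX + SF) <= Q * s by rewrite leq_mul2l sE orbT.
have c3 : Q <= Q * s by rewrite leq_pmulr.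
rewrite mulnDr in c2; rewrite (mulnC s); lia.
Qed.

Lemma reduction_polylog H a d n s (h := height H d) :
  0 < d -> n <= s -> 1 < s -> d <= (trunc_log 2 s).+1 ^ a ->
  2 ^ h * ((d + 8 * h).+1 * (bitlen n + 2 * h + 6)) <=
  (2 ^ H * 2 * 2 ^ a) * (9 * 2 ^ a + 8 * H + 1) * (2 * 2 ^ a + 2 * H + 8) *
  trunc_log 2 s ^ (a.+1 * 3).
Proof.
move=> d0 ns s1 dle.
set l := trunc_log 2 s in dle *.
have l0 : 0 < l by rewrite trunc_log_gt0.
(* [Y] dominates [l], and [2 ^ a * Y] dominates [d]. Each of the three factors is then at most a
   constant times [Y], whence the exponent [a.+1 * 3]. *)
set Y := l ^ a.+1.
have lY : l <= Y by rewrite /Y expnS leq_pmulr // expn_gt0 l0.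
have Y0 : 0 < Y by apply: leq_trans lY.
have dY : d <= 2 ^ a * Y.
  apply: (leq_trans dle); apply: (@leq_trans ((2 * l) ^ a)).
    by case: (posnP a) => [->|a0] //; rewrite leq_exp2r //; lia.
  by rewrite expnMn leq_mul2l /Y expnS leq_pmull ?orbT.
have bd : bitlen d <= d by rewrite bitlen_leP // ltn_expl.
have hd : h <= H + d by rewrite /h /height; lia.
have Nle : 2 ^ h <= (2 ^ H * 2 * 2 ^ a) * Y.
  have b2 : 2 ^ bitlen d <= 2 * d by rewrite expnS leq_mul2l trunc_logP.
  apply: (@leq_trans (2 ^ H * 2 ^ bitlen d)).
    by rewrite -expnD leq_exp2l // /h /height; lia.
  rewrite -!mulnA leq_mul2l; apply/orP; right; apply: (leq_trans b2).
  by rewrite leq_mul2l dY.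
have bn : bitlen n <= l.+1 by rewrite ltnS leq_trunc_log.
set K := 2 ^ a in dY *.
have Ale : (d + 8 * h).+1 <= (9 * K + 8 * H + 1) * Y by nia.
have Ble : bitlen n + 2 * h + 6 <= (2 * K + 2 * H + 8) * Y by nia.
have := leq_mul Nle (leq_mul Ale Ble) => /leq_trans; apply.
by rewrite expnM -/Y !expnS expn0; lia.
Qed.

(** * Assembly of the reduction *)

Lemma big_family_members (R : realType) (c : R) (I : big_family c) :
  {in members I, forall C, uniq C /\ {subset C <= ground I}}.
Proof. by move=> C /(allP (members_set I)) /andP[uC /allP]. Qed.

Lemma big_family_exponent (R : realType) (c : R) (I : big_family c) :
  (0 < c -> 1 < c)%R.
Proof.
move=> c0; apply: (@family_exponent_gt1 _ _ _ _ c0 _ (ground_small I)).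
exact: size_distinct_sets (@big_family_members _ _ I) (members_distinct I).
Qed.

Theorem theorem3 (R : realType) (c : R) (hc : (0 < c)%R) :
  BigTwoDisjointSets c <=ql BigSpernerFamily c.
Proof.
have [c1|c1] := boolP (1 < c)%R; last first.
  (* For [c <= 1] there is no instance, so every claim about one is vacuous. *)
  exists id; split; last by move=> I; have := big_family_exponent I hc; rewrite (negbTE c1).
  exists Skip, (fun=> 0); split; last by exists 0, 0, 0.
  by move=> I; have := big_family_exponent I hc; rewrite (negbTE c1).
have [H H0 H8] := exists_height c1.
pose h (I : big_family c) := height H (size (ground I)).
have Hh I : 0 < H <= h I by rewrite H0 leq_maxl.
have h0 I : 0 < h I by apply: leq_trans H0 (leq_maxl _ _).
have ltX I : size (ground I) < 2 ^ h I.
  by apply: leq_trans (ltn_bitlen _) _; rewrite leq_exp2l // leq_maxr.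
have members_gt1 (I : big_family c) := family_size_gt1 hc (ground_small I).
have small I : ((size (iota 1 (size (ground I) + 8 * h I)))%:R <
    log2 (size (gadget_family (ground I) (h I) (members I)))%:R `^ c)%R.
  rewrite size_iota size_gadget_family.
  exact: gadget_family_small c1 H8 (Hh I) (ground_small I).
pose Phi (I : big_family c) : big_family c :=
  BigFamily (iota_uniq 1 (size (ground I) + 8 * h I))
    (gadget_family_sets (ground I) (h I) (members I))
    (gadget_family_distinct (ltX I) (h0 I) (@big_family_members _ _ I)
       (members_distinct I))
    (small I).
exists Phi; split; last first.
  move=> I; exact: gadget_family_output (ltX I) (h0 I)
    (@big_family_members _ _ I) (members_distinct I) (members_gt1 I).
have ground_gt0 (I : big_family c) : 0 < size (ground I).
  have := size_distinct_sets (@big_family_members _ _ I) (members_distinct I).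
  by case: (size (ground I)) => // /(leq_trans (members_gt1 I)).
pose B (I : big_family c) := bitlen (size (members I)) + 2 * h I + 6.
have B0 I : 0 < B I by rewrite /B addnS.
(* Runs are only known to exist, so their time as a function of the instance is obtained by
   choice. *)
have /choice[T TP] : forall I : big_family c, exists t,
    computes (reduction H) (encode_family I) t (encode_family (Phi I)) /\
    t <= 400 * (isize (P := BigTwoDisjointSets c) I *
      (2 ^ h I * ((size (ground I) + 8 * h I).+1 * B I))).
  move=> I; have [t [s [run le outE]]] := reduction_runs H0 (ground_gt0 I)
    (ground_uniq I) (@big_family_members _ _ I).
  exists t; split; last exact: leq_trans le (reduction_time _ _ _ (B0 I)).
  exists s; split=> //; rewrite outE /encode_family /=.
  by rewrite gadget_family_words size_gadget_family.
exists (reduction H), T; split; first by move=> I; have [] := TP I.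
pose a := Num.bound c.
have ca : (c <= a%:R)%R by apply/ltW/archi_boundP/ltW.
pose K := (2 ^ H * 2 * 2 ^ a) * (9 * 2 ^ a + 8 * H + 1) * (2 * 2 ^ a + 2 * H + 8).
(* From size 2 on the truncated logarithm is positive. *)
exists (a.+1 * 3), (400 * K), 2 => I s2.
have [_ /leq_trans] := TP I; apply.
have ns := family_size_ge (ground I) (members I).
have := reduction_polylog H (ground_gt0 I) ns s2 (ground_polylog hc ca ns (ground_small I)).
rewrite -/K -/(h I) -/(B I) => le.
by rewrite -(mulnA 400 K) (mulnCA K); do 2 apply: leq_mul => //.
Qed.
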